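(* Let $\rho_{ABC}$ be a state on $\mathcal{H}_A\otimes\mathcal{H}_B\otimes\mathcal{H}_C$ (finite-dimensional, $\dim\mathcal{H}_A=d$), and let $M_1,M_2$ be two measurements on $A$ given by orthonormal bases $\{|\varphi^1_j\rangle\}_{j=1}^d$ and $\{|\varphi^2_k\rangle\}_{k=1}^d$. Then $$S(M_1|B)+S(M_2|C)\ \ge\ Q^{M_{1,2}}+\max\{0,\Delta\},\qquad \Delta=S(A)-\mathcal{I}(M_1:B)-\mathcal{I}(M_2:C),$$ where $Q^{M_{1,2}}$ may be taken to be any one of $\widetilde q^{M_{1,2}}$, $q^{M_{1,2}}(\rho_A)$, $q^{M_{1,2}}$ defined below.
   Context: All logarithms are base 2. For a state $\sigma$, $S(\sigma)=-\mathrm{tr}\,\sigma\log_2\sigma$; $S(A)=S(\rho_A)$ with $\rho_A$ the reduced state. For a measurement $M$ on $A$ given by an orthonormal basis $\{|\varphi_j\rangle\}$ and a subsystem $X$ (here $X=B$ or $C$), $\rho_{MX}=\sum_j(|\varphi_j\rangle\langle\varphi_j|\otimes I_X)\rho_{AX}(|\varphi_j\rangle\langle\varphi_j|\otimes I_X)$, $S(M|X)=S(\rho_{MX})-S(\rho_X)$, $H(M)=-\sum_j p_j\log_2 p_j$ with $p_j=\langle\varphi_j|\rho_A|\varphi_j\rangle$, and the Holevo quantity is $\mathcal{I}(M:X)=H(M)+S(\rho_X)-S(\rho_{MX})$. For two measurements $M_i,M_j$ with bases $\{|\varphi^i_k\rangle\}$, $\{|\varphi^j_l\rangle\}$, let $c^{i,j}_{kl}=|\langle\varphi^i_k|\varphi^j_l\rangle|^2$,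 $c^{i,j}_{\max}=\max_{k,l}c^{i,j}_{kl}$, $c^{i,j}_2$ the second largest element of the matrix $[c^{i,j}_{kl}]$, and $q^{M_{i,j}}_{MU}=-\log_2 c^{i,j}_{\max}$. Define: (i) $\widetilde q^{M_{i,j}}=q^{M_{i,j}}_{MU}+\tfrac12(1-\sqrt{c^{i,j}_{\max}})\log_2\frac{c^{i,j}_{\max}}{c^{i,j}_2}$; (ii) $q^{M_{i,j}}(\rho_A)=\max\{\sum_k p^{i}_k\log_2(1/\max_l c^{i,j}_{kl}),\ \sum_l p^{j}_l\log_2(1/\max_k c^{i,j}_{kl})\}$ with $p^i_k=\langle\varphi^i_k|\rho_A|\varphi^i_k\rangle$, $p^j_l=\langle\varphi^j_l|\rho_A|\varphi^j_l\rangle$; (iii) $q^{M_{i,j}}=\max_{0\le p\le1}\lambda_{\min}[p\Delta_{M_iM_j}+(1-p)\Delta_{M_jM_i}]$, where $\lambda_{\min}$ is the smallest eigenvalue, $\Delta_{M_iM_j}=\sum_k\log_2(1/\max_l c^{i,j}_{kl})|\varphi^i_k\rangle\langle\varphi^i_k|$ and $\Delta_{M_jM_i}=\sum_l\log_2(1/\max_k c^{i,j}_{kl})|\varphi^j_l\rangle\langle\varphi^j_l|$. $Q^{M_{i,j}}$ denotes any one of these three quantities. *)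

(* Defs.v *)
From HB Require Import structures.
From mathcomp Require Import all_boot all_order all_algebra.
From mathcomp Require Import sesquilinear spectral.
From mathcomp Require Import complex mxtens.
From mathcomp Require Import boolp classical_sets reals exp.

Set Implicit Arguments.
Unset Strict Implicit.
Unset Printing Implicit Defensive.

Import Order.TTheory GRing.Theory Num.Theory.
Local Open Scope ring_scope.
Local Open Scope sesquilinear_scope.
Local Open Scope complex_scope.

Section QDefs.
Variable R : realType.
Local Notation C := R[i].

Definition log2 (x : R) : R := ln x / ln 2.
(* x log2 x  (with 0 log 0 = 0, since ln 0 = 0 and 0 * _ = 0) *)
Definition xlog2 (x : R) : R := x * log2 x.

(* von Neumann entropy S(s) = - tr s log2 s = - sum_i lambda_i log2 lambda_i,
   where lambda_i are the eigenvalues of s, given by the spectral decomposition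
   s = P^-1 diag(lambda) P (P unitary) of the normal (here Hermitian) matrix s. *)
Definition vN_entropy n (s : 'M[C]_n) : R :=
  - \sum_(i < n) xlog2 (complex.Re (spectral_diag s 0 i)).

Definition lambda_min n (H : 'M[C]_n) : R :=
  head 0 (sort <=%R [seq complex.Re (spectral_diag H 0 i) | i <- enum 'I_n]).

Definition psdmx n (s : 'M[C]_n) : Prop :=
  s \is hermsymmx /\ forall v : 'cV[C]_n, 0 <= (v ^t* *m s *m v) 0 0.
Definition density_mx n (s : 'M[C]_n) : Prop := psdmx s /\ \tr s = 1.

Definition orthonormal_basis d (phi : 'I_d -> 'cV[C]_d) : Prop :=
  forall j k, (phi j) ^t* *m phi k = (j == k)%:R%:M.

Definition proj n (v : 'cV[C]_n) : 'M[C]_n := v *m v ^t*.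

Section Reduced.
Variables dA dB dC : nat.
Definition idx3 (a : 'I_dA) (b : 'I_dB) (c : 'I_dC) : 'I_(dA * (dB * dC)) :=
  mxtens_index (a, mxtens_index (b, c)).

Variable rho : 'M[C]_(dA * (dB * dC)).

Definition rhoA : 'M[C]_dA :=
  \matrix_(a, a') \sum_(b < dB) \sum_(c < dC) rho (idx3 a b c) (idx3 a' b c).
Definition rhoB : 'M[C]_dB :=
  \matrix_(b, b') \sum_(a < dA) \sum_(c < dC) rho (idx3 a b c) (idx3 a b' c).
Definition rhoC : 'M[C]_dC :=
  \matrix_(c, c') \sum_(a < dA) \sum_(b < dB) rho (idx3 a b c) (idx3 a b c').
Definition rhoAB : 'M[C]_(dA * dB) :=
  \matrix_(i, j) \sum_(c < dC)
     rho (idx3 (mxtens_unindex i).1 (mxtens_unindex i).2 c)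
         (idx3 (mxtens_unindex j).1 (mxtens_unindex j).2 c).
Definition rhoAC : 'M[C]_(dA * dC) :=
  \matrix_(i, j) \sum_(b < dB)
     rho (idx3 (mxtens_unindex i).1 b (mxtens_unindex i).2)
         (idx3 (mxtens_unindex j).1 b (mxtens_unindex j).2).
End Reduced.

Section Measurement.
Variable d : nat.
Variable phi : 'I_d -> 'cV[C]_d.

Definition meas_prob (sA : 'M[C]_d) (j : 'I_d) : R :=
  complex.Re (((phi j) ^t* *m sA *m phi j) 0 0).

Definition shannonM (sA : 'M[C]_d) : R := - \sum_(j < d) xlog2 (meas_prob sA j).

Definition meas_state n (sAX : 'M[C]_(d * n)) : 'M[C]_(d * n) :=
  \sum_(j < d) ((proj (phi j) *t (1%:M : 'M[C]_n)) *m sAX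
                  *m (proj (phi j) *t (1%:M : 'M[C]_n))).

Definition cond_entropy n (sAX : 'M[C]_(d * n)) (sX : 'M[C]_n) : R :=
  vN_entropy (meas_state sAX) - vN_entropy sX.

Definition holevo n (sA : 'M[C]_d) (sAX : 'M[C]_(d * n)) (sX : 'M[C]_n) : R :=
  shannonM sA + vN_entropy sX - vN_entropy (meas_state sAX).
End Measurement.

Section Overlaps.
Variable d : nat.
Variables phi1 phi2 : 'I_d -> 'cV[C]_d.

Definition overlap (k l : 'I_d) : R := Normc.normc (((phi1 k) ^t* *m phi2 l) 0 0) ^+ 2.

(* all entries are >= 0, so 0 is a neutral element for max *)
Definition c_max : R := \big[Num.max/0]_(k < d) \big[Num.max/0]_(l < d) overlap k l.

(* second largest element of the matrix [c_{kl}] (counted with multiplicity) *)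
Definition c_2 : R :=
  nth 0 (sort >=%R [seq overlap k l | k <- enum 'I_d, l <- enum 'I_d]) 1.

Definition q_MU : R := - log2 c_max.

Definition q_tilde : R :=
  q_MU + 2^-1 * (1 - Num.sqrt c_max) * log2 (c_max / c_2).

Definition row_max (k : 'I_d) : R := \big[Num.max/0]_(l < d) overlap k l.
Definition col_max (l : 'I_d) : R := \big[Num.max/0]_(k < d) overlap k l.

Definition q_state (sA : 'M[C]_d) : R :=
  Num.max (\sum_(k < d) meas_prob phi1 sA k * log2 (1 / row_max k))
          (\sum_(l < d) meas_prob phi2 sA l * log2 (1 / col_max l)).

Definition Delta12 : 'M[C]_d :=
  \sum_(k < d) (log2 (1 / row_max k))%:C *: proj (phi1 k).
Definition Delta21 : 'M[C]_d :=
  \sum_(l < d) (log2 (1 / col_max l))%:C *: proj (phi2 l).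

(* (iii): max over p in [0,1] (attained, by continuity), written as a sup *)
Definition q_opt : R :=
  sup [set lambda_min (p%:C *: Delta12 + (1 - p)%:C *: Delta21)
      | p in [set p : R | 0 <= p <= 1]].
End Overlaps.

End QDefs.

(* Main.v *)
Require Import Defs.
From HB Require Import structures.
From mathcomp Require Import all_boot all_order all_algebra.
From mathcomp Require Import sesquilinear spectral.
From mathcomp Require Import complex mxtens ring lra.
From mathcomp Require Import boolp classical_sets reals exp.

(** The inequality without [Delta] is a relative-entropy estimate. Purify [rho]
    by a system [D]; then [S(M_1|B) = S(M_1CD) - S(ACD)] is the relative entropy
    of [rho_ACD] with respect to its pinching by [M_1], and monotonicity under
    measuring [M_2] and discarding [D] bounds it below by
    [sum_l D(r_l || kap_l rho_C)], where [r_l] is the unnormalised state of [C]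
    after outcome [l] of [M_2] and [kap_l] is the largest overlap in column [l].
    This sum is [- S(M_2|C) + sum_l p_l log (1 / kap_l)].

    Monotonicity is proved without operator convexity. For [s > 0] the form
    [<rho, (L_sigma + s R_rho)^-1 rho>] is the maximum over [V] of the concave
    form [2 Re tr(rho V^* ) - tr(V^* sigma V) - s tr(V rho V^* )], so comparing
    two such forms only requires transporting test matrices [V]. In eigenbases
    each form is a sum of fractions in [s] whose primitive is a sum of
    logarithms, and integrating from [0] to infinity gives relative entropies.

    The same estimate for the single system [A] reads
    [H(M_1) + H(M_2) >= S(A) + sum_l p_l log (1 / kap_l)], which is the
    inequality with [Delta]. Finally [q_tilde] and [q_opt] are at most [q_state]. *)

Set Implicit Arguments.
Unset Strict Implicit.
Unset Printing Implicit Defensive.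

Import Order.TTheory GRing.Theory Num.Theory.
Local Open Scope ring_scope.
Local Open Scope sesquilinear_scope.
Local Open Scope complex_scope.

(** * Comparison of logarithmic sums through their derivatives *)

Section LogComparison.
Variable R : realType.

Lemma ln_diff_le (x y : R) : 0 < x -> 0 < y -> ln x - ln y <= (x - y) / y.
Proof.
move=> x0 y0; rewrite -ln_div ?posrE//.
have -> : x / y = 1 + (x - y) / y by field; rewrite gt_eqF.
by apply: le_ln1Dx; rewrite mulrBl divff ?gt_eqF// ltrBrDl addrN divr_gt0.
Qed.

(** Riemann sums replace integration: on a partition of [[s, t]] into equal steps, left sums of [F2]
    bound the growth of [Psi2] from above and right sums of [F1] bound that of [Psi1] from below.
    The mismatch between left and right sums telescopes. *)
Lemma sum_deriv_le_increment (Psi1 Psi2 F1 F2 : R -> R) :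
  (forall s t : R, 0 < s <= t -> Psi2 t - Psi2 s <= (t - s) * F2 s) ->
  (forall s t : R, 0 < s <= t -> (t - s) * F1 t <= Psi1 t - Psi1 s) ->
  (forall s : R, 0 < s -> F2 s <= F1 s) ->
  forall s t : R, 0 < s <= t -> Psi2 t - Psi2 s <= Psi1 t - Psi1 s.
Proof.
move=> h2 h1 h12 s t /andP[s0 st].
apply/ler_addgt0Pr => e e0.
(* With [n.+1] steps the telescoped error is [K / n.+1]; [n] is chosen to bring it below [e]. *)
pose K : R := (t - s) * (F2 s - F2 t).
have [n Kn] : exists n : nat, `|K| / e < n.+1%:R.
  exists (Num.truncn (`|K| / e)); exact: truncnS_gt.
pose D : R := (t - s) / n.+1%:R.
have D0 : 0 <= D by rewrite divr_ge0// subr_ge0.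
have step k : let x j : R := s + j%:R * D in
    Psi2 (x k) - Psi2 s - (Psi1 (x k) - Psi1 s) <= D * (F2 s - F2 (x k)).
  elim: k => [|k IH] x; first by rewrite /x mulr0n mul0r addr0 !subrr mulr0.
  have xk0 : 0 < x k by rewrite ltr_pwDl// mulr_ge0.
  have xS : x k.+1 = x k + D by rewrite /x -natr1; ring.
  have ok : 0 < x k <= x k.+1 by rewrite xk0 xS lerDl.
  have xS0 : 0 < x k.+1 by case/andP: ok => a; apply: lt_le_trans.
  have a2 := h2 _ _ ok; have a1 := h1 _ _ ok.
  have a12 : D * F2 (x k.+1) <= D * F1 (x k.+1) by rewrite ler_wpM2l// h12.
  have dx : x k.+1 - x k = D by rewrite xS; ring.
  rewrite dx in a1 a2; move: IH; rewrite -/(x k) /=; nra.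
have := step n.+1; rewrite /= (_ : n.+1%:R * D = t - s); last first.
  by rewrite /D mulrC divfK// pnatr_eq0.
rewrite (_ : s + (t - s) = t); last by ring.
rewrite (_ : D * _ = K / n.+1%:R); last by rewrite /D /K; ring.
move=> le1.
have : K / n.+1%:R <= e.
  rewrite ler_pdivrMr// (le_trans (ler_norm _))// mulrC -ler_pdivrMr//.
  exact: ltW.
move=> /(le_trans le1); rewrite lerBlDr => /le_trans -> //; lra.
Qed.

Section Family.
Variables (I : finType) (w la mu : I -> R).
Hypothesis w_ge0 : forall i, 0 <= w i.
Hypothesis w_supp : forall i, w i != 0 -> 0 < la i /\ 0 < mu i.

Definition resolvent_sum (s : R) := \sum_i w i * (la i / (mu i + s * la i)).
Let Psi (s : R) := \sum_i w i * ln (mu i + s * la i).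

(** This admits singular matrices: terms of weight zero vanish on both sides, so the default values
    of [ln] and of division at zero eigenvalues never matter. *)
Lemma weighted_le (f g : I -> R) :
  (forall i, 0 < la i -> 0 < mu i -> f i <= g i) ->
  \sum_i w i * f i <= \sum_i w i * g i.
Proof.
move=> fg; apply: ler_sum => i _.
have [->|/w_supp[l0 m0]] := eqVneq (w i) 0; first by rewrite !mul0r.
by rewrite ler_wpM2l// fg.
Qed.

Lemma resolvent_primitive_le s t : 0 < s <= t ->
  Psi t - Psi s <= (t - s) * resolvent_sum s.
Proof.
move=> /andP[s0 st]; rewrite /Psi /resolvent_sum mulr_sumr -sumrB.
under eq_bigr do rewrite -mulrBr.
under [leRHS]eq_bigr do rewrite mulrCA.
apply: weighted_le => i l0 m0.
have a : 0 < mu i + s * la i by rewrite addr_gt0// mulr_gt0.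
have b : 0 < mu i + t * la i by rewrite addr_gt0// mulr_gt0// (lt_le_trans s0).
apply: le_trans (ln_diff_le b a) _; rewrite mulrA le_eqVlt.
by apply/orP; left; apply/eqP; congr (_ / _); ring.
Qed.

Lemma resolvent_primitive_ge s t : 0 < s <= t ->
  (t - s) * resolvent_sum t <= Psi t - Psi s.
Proof.
move=> /andP[s0 st]; rewrite /Psi /resolvent_sum mulr_sumr -sumrB.
under [leRHS]eq_bigr do rewrite -mulrBr.
under [leLHS]eq_bigr do rewrite mulrCA.
apply: weighted_le => i l0 m0.
have a : 0 < mu i + s * la i by rewrite addr_gt0// mulr_gt0.
have b : 0 < mu i + t * la i by rewrite addr_gt0// mulr_gt0// (lt_le_trans s0).
rewrite -lerN2 opprB.
apply: le_trans (ln_diff_le a b) _; rewrite -mulNr mulrA le_eqVlt.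
by apply/orP; left; apply/eqP; congr (_ / _); ring.
Qed.

(** This bound and the next three locate [Psi s] up to [O(s)] near zero and, once
    [(\sum_i w i) * ln s] is removed, up to [O(1/s)] near infinity. *)
Lemma resolvent_primitive_ge0 s : 0 < s -> \sum_i w i * ln (mu i) <= Psi s.
Proof.
move=> s0; apply: weighted_le => i l0 m0.
by rewrite ler_ln ?posrE ?addr_gt0 ?mulr_gt0// lerDl mulr_ge0 ?ltW.
Qed.

Lemma resolvent_primitive_le0 s : 0 < s ->
  Psi s <= \sum_i w i * ln (mu i) + s * \sum_i w i * (la i / mu i).
Proof.
move=> s0; rewrite mulr_sumr -big_split /=.
under [leRHS]eq_bigr do rewrite mulrCA -mulrDr.
apply: weighted_le => i l0 m0.
have b : 0 < mu i + s * la i by rewrite addr_gt0// mulr_gt0.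
have := ln_diff_le b m0; rewrite (_ : mu i + _ - _ = s * la i); last by ring.
by rewrite mulrA; lra.
Qed.

Lemma resolvent_primitive_ge_oo s : 0 < s ->
  (\sum_i w i) * ln s + \sum_i w i * ln (la i) <= Psi s.
Proof.
move=> s0; rewrite mulr_suml -big_split /=.
under eq_bigr do rewrite -mulrDr.
apply: weighted_le => i l0 m0.
rewrite -lnM ?posrE// ler_ln ?posrE ?mulr_gt0//; last by rewrite addr_gt0 ?mulr_gt0.
by rewrite lerDr ltW.
Qed.

Lemma resolvent_primitive_le_oo s : 0 < s ->
  Psi s <= (\sum_i w i) * ln s + \sum_i w i * ln (la i)
           + (\sum_i w i * (mu i / la i)) / s.
Proof.
move=> s0; rewrite !mulr_suml -!big_split /=.
under [leRHS]eq_bigr do rewrite -mulrA -!mulrDr.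
apply: weighted_le => i l0 m0.
have b : 0 < mu i + s * la i by rewrite addr_gt0// mulr_gt0.
have c : 0 < s * la i by rewrite mulr_gt0.
have := ln_diff_le b c; rewrite lnM ?posrE//.
rewrite (_ : (mu i + _ - _) / _ = mu i / la i / s); last by field; rewrite !gt_eqF.
by lra.
Qed.

End Family.

(* The function [s |-> \sum_i w i * ln (mu i + s * la i)], with derivative
   [resolvent_sum], interpolates between [\sum_i w i * ln (mu i)] at [0] and,
   up to the common term [(\sum_i w i) * ln s], [\sum_i w i * ln (la i)] at
   infinity. *)
Lemma resolvent_sum_le_log (I J : finType) (w la mu : I -> R) (w' la' mu' : J -> R) :
  (forall i, 0 <= w i) -> (forall i, w i != 0 -> 0 < la i /\ 0 < mu i) ->
  (forall j, 0 <= w' j) -> (forall j, w' j != 0 -> 0 < la' j /\ 0 < mu' j) ->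
  \sum_i w i = \sum_j w' j ->
  (forall s : R, 0 < s -> resolvent_sum w' la' mu' s <= resolvent_sum w la mu s) ->
  \sum_j w' j * (ln (la' j) - ln (mu' j)) <= \sum_i w i * (ln (la i) - ln (mu i)).
Proof.
move=> w0 ws w'0 w's eqw le12.
under eq_bigr do rewrite mulrBr; under [leRHS]eq_bigr do rewrite mulrBr.
rewrite !sumrB.
set E1 := \sum_i w i * ln (la i); set A1 := \sum_i w i * ln (mu i).
set E2 := \sum_i w' i * ln (la' i); set A2 := \sum_i w' i * ln (mu' i).
pose C := \sum_i w i * (mu i / la i); pose C' := \sum_i w' i * (la' i / mu' i).
have C0 : 0 <= C.
  rewrite -[leLHS](mulr0 (\sum_i w i)) mulr_suml.
  by apply: (weighted_le w0 ws) => // i l0 m0; rewrite divr_ge0 ?ltW.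
have C'0 : 0 <= C'.
  rewrite -[leLHS](mulr0 (\sum_j w' j)) mulr_suml.
  by apply: (weighted_le w'0 w's) => // i l0 m0; rewrite divr_ge0 ?ltW.
(* Increments are compared between [s] and [s^-1]. Equal total weights cancel the [ln s] terms; the
   endpoint errors are [s * C'] at [s] and [s * C] at [s^-1]. *)
suff main s : 0 < s <= 1 -> E2 - A2 <= E1 - A1 + s * (C + C').
  apply/ler_addgt0Pr => e e0; set K := C + C' in main.
  have K0 : 0 <= K by rewrite addr_ge0.
  have mle : Num.min 1 (e / (K + 1)) <= e / (K + 1) by rewrite ge_min lexx orbT.
  apply: le_trans (main (Num.min 1 (e / (K + 1))) _) _.
    by rewrite lt_min ltr01 divr_gt0 ?ge_min ?lexx// ltr_wpDl.
  rewrite lerD2l; apply: le_trans (ler_wpM2r K0 mle) _.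
  rewrite -mulrA ger_pMr// mulrC ler_pdivrMr ?mul1r ?lerDl//.
  by rewrite ltr_wpDl.
move=> /andP[s0 s1]; have si0 : 0 < s^-1 by rewrite invr_gt0.
have ss : 0 < s <= s^-1 by rewrite s0/= (le_trans s1)// invf_ge1.
have := sum_deriv_le_increment (resolvent_primitive_le w'0 w's)
  (resolvent_primitive_ge w0 ws) le12 ss.
have a1 := resolvent_primitive_ge0 w0 ws s0.
have a2 := resolvent_primitive_le0 w'0 w's s0.
have a3 := resolvent_primitive_le_oo w0 ws si0.
have a4 := resolvent_primitive_ge_oo w'0 w's si0.
move: a1 a2 a3 a4; rewrite -eqw invrK -/E1 -/E2 -/A1 -/A2 -/C -/C'.
by lra.
Qed.

End LogComparison.

(** * Adjoints, characteristic polynomials and entropy *)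

Section Adjoint.
Variable R : realType.
Local Notation C := R[i].

Lemma adjmxE m n (A : 'M[C]_(m, n)) i j : (A ^t*) i j = Num.conj (A j i).
Proof. by rewrite !mxE. Qed.

Lemma adjmxM m n p (A : 'M[C]_(m, n)) (B : 'M[C]_(n, p)) :
  (A *m B) ^t* = B ^t* *m A ^t*.
Proof. by rewrite trmx_mul map_mxM. Qed.

Lemma adjmx_sum m n (I : finType) (F : I -> 'M[C]_(m, n)) :
  (\sum_i F i) ^t* = \sum_i (F i) ^t*.
Proof. by rewrite linear_sum map_mx_sum. Qed.

Lemma adjmx1 n : (1%:M : 'M[C]_n) ^t* = 1%:M.
Proof. by rewrite trmx1 map_mx1. Qed.

Lemma mul_adj_unitary n (U : 'M[C]_n) : U \is unitarymx -> U ^t* *m U = 1%:M.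
Proof. by rewrite -trmxC_unitary => /unitarymxP; rewrite trmxCK. Qed.

Lemma mxtrace_mul_diag_adj m n (A : 'M[C]_(m, n)) (d : 'rV[C]_n) (B : 'M[C]_(m, n)) :
  \tr (A *m diag_mx d *m B ^t*) = \sum_i \sum_j A i j * d 0 j * Num.conj (B i j).
Proof.
apply: eq_bigr => i _; rewrite mxE; apply: eq_bigr => j _.
by rewrite mul_mx_diag !mxE.
Qed.

End Adjoint.

(** Block elimination in [P] from the right exposes ['X%:M - A' *m B'], and from the left
    ['X%:M - B' *m A']; both determinants are then read off [\det P]. *)
Lemma char_poly_mulC (F : comNzRingType) m n (A : 'M[F]_(m, n)) (B : 'M[F]_(n, m)) :
  char_poly (A *m B) * 'X^n = char_poly (B *m A) * 'X^m.
Proof.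
rewrite /char_poly /char_poly_mx !map_mxM.
set A' := map_mx _ A; set B' := map_mx _ B.
pose P := block_mx 'X%:M A' B' 1%:M.
have e1 : \det P = \det ('X%:M - A' *m B').
  have : P *m block_mx 1%:M 0 (- B') 1%:M = block_mx ('X%:M - A' *m B') A' 0 1%:M.
    rewrite mulmx_block !mulmx1 !mulmx0 !mul1mx add0r add0r mulmxN.
    by rewrite subrr.
  move/(congr1 determinant); rewrite det_mulmx det_lblock det_ublock !det1.
  by rewrite !mulr1.
have e2 : 'X^n * \det P = 'X^m * \det ('X%:M - B' *m A').
  have : block_mx 1%:M 0 (- B') 'X%:M *m P
       = block_mx 'X%:M A' 0 ('X%:M - B' *m A').
    rewrite mulmx_block !mul1mx !mul0mx !addr0 mulmx1 !mulNmx.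
    by rewrite mul_mx_scalar mul_scalar_mx addNr addrC.
  move/(congr1 determinant); rewrite det_mulmx det_lblock det_ublock det1.
  by rewrite !det_scalar mul1r.
by rewrite -e1 mulrC e2 mulrC.
Qed.

Lemma char_poly_trmx (F : comNzRingType) n (A : 'M[F]_n) :
  char_poly A^T = char_poly A.
Proof.
rewrite /char_poly -[RHS]det_tr /char_poly_mx; congr (\det _).
by rewrite linearB /= tr_scalar_mx map_trmx.
Qed.

Lemma char_poly_conj (F : fieldType) n (P A : 'M[F]_n) : P \in unitmx ->
  char_poly (invmx P *m A *m P) = char_poly A.
Proof.
move=> Pu; have := char_poly_mulC (invmx P *m A) P.
rewrite mulmxA mulmxV// mul1mx; apply: mulIf.
by rewrite expf_neq0// polyX_eq0.
Qed.

Lemma char_poly_diag (F : comNzRingType) n (d : 'rV[F]_n) :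
  char_poly (diag_mx d) = \prod_(x <- [seq d 0 i | i <- enum 'I_n]) ('X - x%:P).
Proof.
rewrite char_poly_trig ?diag_mx_is_trig// big_map big_enum /=.
by apply: eq_bigr => i _; rewrite !mxE eqxx.
Qed.

Section Entropy.
Variable R : realType.
Local Notation C := R[i].

Lemma conjC_real_complex (x : R) : Num.conj (x%:C : C) = x%:C.
Proof. exact: conjc_real. Qed.

Definition rdiag n (la : 'I_n -> R) : 'M[C]_n := diag_mx (\row_i (la i)%:C).

(** Unique factorization recovers the eigenvalues up to permutation. Extra zero roots cost nothing,
    since [xlog2 0 = 0]; the factor ['X^k] thus allows matrices of different sizes to be
    compared. *)
Lemma vN_entropy_char_poly n (s : 'M[C]_n) (r : seq C) k : s \is normalmx ->
  char_poly s * 'X^k = \prod_(x <- r) ('X - x%:P) ->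
  vN_entropy s = - \sum_(x <- r) xlog2 (complex.Re x).
Proof.
move=> /orthomx_spectralP s_eq; rewrite {1}s_eq char_poly_conj ?spectral_unit//.
rewrite char_poly_diag.
have -> : 'X^k = \prod_(x <- nseq k (0 : C)) ('X - x%:P) :> {poly C}.
  by rewrite big_nseq subr0 iter_mulr_1.
rewrite -big_cat /= => /prod_XsubC_eq pr.
rewrite /vN_entropy -(perm_big _ pr) big_cat big_map big_enum /=.
by rewrite big_nseq /xlog2 mul0r iter_addr_0 mul0rn addr0.
Qed.

Lemma rdiag_conj_normal n (U : 'M[C]_n) la : U \is unitarymx ->
  U ^t* *m rdiag la *m U \is normalmx.
Proof.
move=> Uu; apply: hermitian_normalmx; apply/is_hermitianmxP.
rewrite expr0 scale1r !adjmxM trmxCK mulmxA; congr (_ *m _ *m _).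
rewrite tr_diag_mx map_diag_mx; congr diag_mx; apply/rowP => i.
by rewrite !mxE /= conjC_real_complex.
Qed.

Lemma vN_entropy_diag n (U : 'M[C]_n) la : U \is unitarymx ->
  vN_entropy (U ^t* *m rdiag la *m U) = - \sum_i xlog2 (la i).
Proof.
move=> Uu.
rewrite (@vN_entropy_char_poly _ _ [seq (la i)%:C | i <- enum 'I_n] 0); last 2 first.
- exact: rdiag_conj_normal.
- rewrite mulr1 -invmx_unitary// char_poly_conj ?unitarymx_unit// char_poly_diag.
  by rewrite !big_map; apply: eq_bigr => i _; rewrite mxE.
by rewrite big_map big_enum.
Qed.

Lemma vN_entropy_cospectral m n (s : 'M[C]_m) (t : 'M[C]_n) :
  s \is normalmx -> t \is normalmx ->
  char_poly s * 'X^n = char_poly t * 'X^m -> vN_entropy s = vN_entropy t.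
Proof.
move=> sN tN st; have /orthomx_spectralP t_eq := tN.
set r := [seq spectral_diag t 0 i | i <- enum 'I_n] ++ nseq m 0.
have tr : char_poly t * 'X^m = \prod_(x <- r) ('X - x%:P).
  rewrite {1}t_eq (char_poly_conj _ (spectral_unit t)) char_poly_diag big_cat /=.
  by rewrite big_nseq subr0 iter_mulr_1.
by rewrite (vN_entropy_char_poly tN tr) (vN_entropy_char_poly sN (etrans st tr)).
Qed.

Lemma gram_hermitian m n (M : 'M[C]_(m, n)) : M *m M ^t* \is hermsymmx.
Proof. by apply/is_hermitianmxP; rewrite expr0 scale1r adjmxM trmxCK. Qed.

(** This stands in for the Schmidt decomposition: with [M] read as a pure bipartite vector, the two
    matrices are its reduced states, the transpose coming from the partial trace over the first
    factor. *)
Lemma vN_entropy_gram m n (M : 'M[C]_(m, n)) :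
  vN_entropy (M *m M ^t*) = vN_entropy (M ^t* *m M)^T.
Proof.
apply: vN_entropy_cospectral.
- exact/hermitian_normalmx/gram_hermitian.
- apply: hermitian_normalmx; rewrite trmx_mul.
  have -> : (M ^t*)^T = M^T ^t* by apply/matrixP => i j; rewrite !mxE.
  exact: gram_hermitian.
- by rewrite char_poly_trmx char_poly_mulC.
Qed.

Lemma gram_psd m n (M : 'M[C]_(m, n)) : psdmx (M *m M ^t*).
Proof.
split; first exact: gram_hermitian.
move=> v; rewrite mulmxA -mulmxA.
have -> : M ^t* *m v = (v ^t* *m M) ^t* by rewrite adjmxM trmxCK.
rewrite mxE; apply: sumr_ge0 => i _; rewrite !mxE.
by rewrite -normCK exprn_ge0.
Qed.

Lemma hermsym_spectral n (s : 'M[C]_n) : s \is hermsymmx ->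
  s = (spectralmx s) ^t* *m rdiag (fun i => complex.Re (spectral_diag s 0 i)) *m spectralmx s.
Proof.
move=> sH; have /hermitian_normalmx/orthomx_spectralP s_eq := sH.
have dR := hermitian_spectral_diag_real sH.
have dE : spectral_diag s = \row_i (complex.Re (spectral_diag s 0 i))%:C.
  by apply/rowP => i; rewrite mxE RRe_real//; apply: (mxOverP dR).
by rewrite {1}s_eq (invmx_unitary (spectral_unitarymx s)) {1}dE.
Qed.

Lemma psd_spectral n (s : 'M[C]_n) : psdmx s ->
  exists (U : 'M[C]_n) (la : 'I_n -> R),
    [/\ U \is unitarymx, forall i, 0 <= la i & s = U ^t* *m rdiag la *m U].
Proof.
move=> [sH sP]; have s_eq' := hermsym_spectral sH.
have Uu := spectral_unitarymx s.
move: (spectralmx s) (spectral_diag s) s_eq' Uu => U d s_eq' Uu.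
exists U, (fun i => complex.Re (d 0 i)); split => // i.
have := sP (U ^t* *m delta_mx i 0); rewrite adjmxM trmxCK {1}s_eq'.
rewrite !mulmxA -(mulmxA _ U) (unitarymxP Uu) mulmx1.
rewrite -(mulmxA _ U) (unitarymxP Uu) mulmx1.
rewrite mxE (bigD1 i)//= big1; last first.
  by move=> j ji; rewrite [delta_mx _ _ j 0]mxE (negPf ji) mulr0.
rewrite addr0 mul_mx_diag !mxE !eqxx mulr1 /= conjC1 mul1r.
by rewrite ler0c.
Qed.
End Entropy.

(** * The variational form of a pair of positive matrices *)

Section RealTrace.
Variable R : realType.
Local Notation C := R[i].

Definition normc2 (z : C) : R := Normc.normc z ^+ 2.

Lemma normc2E z : normc2 z = complex.Re z ^+ 2 + complex.Im z ^+ 2.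
Proof. by case: z => a b; rewrite /normc2 /= sqr_sqrtr// addr_ge0 ?sqr_ge0. Qed.

Lemma normc2_ge0 z : 0 <= normc2 z. Proof. exact: sqr_ge0. Qed.

Lemma normc2_mulC z : (normc2 z)%:C = z * Num.conj z.
Proof. by rewrite -normCK /normc2 rmorphXn. Qed.

Lemma normc2_conj z : normc2 (Num.conj z) = normc2 z.
Proof. by rewrite !normc2E; case: z => a b /=; rewrite sqrrN. Qed.

Lemma Re_sum (I : finType) (F : I -> C) :
  complex.Re (\sum_i F i) = \sum_i complex.Re (F i).
Proof. exact: (raddf_sum (@complex.Re R : {additive _ -> _})). Qed.

Lemma ReD (x y : C) : complex.Re (x + y) = complex.Re x + complex.Re y.
Proof. by case: x y => ? ? []. Qed.

Lemma Re_mulr (x : C) (a : R) : complex.Re (x * a%:C) = complex.Re x * a.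
Proof. by case: x => b c /=; rewrite mulr0 subr0. Qed.

Definition rtr n (A : 'M[C]_n) : R := complex.Re (\tr A).

Lemma rtr_mulC m n (A : 'M[C]_(m, n)) (B : 'M[C]_(n, m)) :
  rtr (A *m B) = rtr (B *m A).
Proof. by rewrite /rtr mxtrace_mulC. Qed.

Lemma rtrD n (A B : 'M[C]_n) : rtr (A + B) = rtr A + rtr B.
Proof. by rewrite /rtr linearD ReD. Qed.

Lemma rtr_sum n (I : finType) (F : I -> 'M[C]_n) :
  rtr (\sum_i F i) = \sum_i rtr (F i).
Proof. rewrite /rtr -Re_sum; congr complex.Re.
rewrite /mxtrace exchange_big; apply: eq_bigr => i _.
by rewrite summxE. Qed.

Lemma rtrZ n (a : R) (A : 'M[C]_n) : rtr (a%:C *: A) = a * rtr A.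
Proof. by rewrite /rtr linearZ /= mulrC Re_mulr mulrC. Qed.

Lemma rtr_mul_diag_adj m n (A : 'M[C]_(m, n)) (la : 'I_n -> R) (B : 'M[C]_(m, n)) :
  rtr (A *m rdiag la *m B ^t*) =
  \sum_i \sum_j complex.Re (A i j * Num.conj (B i j)) * la j.
Proof.
rewrite /rtr mxtrace_mul_diag_adj Re_sum; apply: eq_bigr => i _.
rewrite Re_sum; apply: eq_bigr => j _.
by rewrite mxE mulrAC Re_mulr.
Qed.

Lemma Re_mul_conj (z : C) : complex.Re (z * Num.conj z) = normc2 z.
Proof. by rewrite -normc2_mulC. Qed.

Section Pair.
Variables (m n : nat) (E : 'M[C]_n) (G : 'M[C]_m) (la : 'I_n -> R) (mu : 'I_m -> R).
Variable J : 'M[C]_(m, n).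
Hypotheses (Eu : E \is unitarymx) (Gu : G \is unitarymx).
Hypotheses (la0 : forall i, 0 <= la i) (mu0 : forall j, 0 <= mu j).
Let rho := E ^t* *m rdiag la *m E.
Let tau := G ^t* *m rdiag mu *m G.
Let X := G *m J *m E ^t*.

(** Nussbaum-Szkola weights: [X] holds the entries of [J] between eigenvectors of [tau] and of
    [rho]. They express a relative entropy of noncommuting matrices as a classical sum. *)
Definition pair_weight (ji : 'I_m * 'I_n) : R := normc2 (X ji.1 ji.2) * la ji.2.

(* Its maximum over [V] is <J rho, (L_tau + s R_rho)^-1 (J rho)>, where [L] and
   [R] denote left and right multiplication. *)
Definition pair_form (s : R) (V : 'M[C]_(m, n)) : R :=
  2 * rtr (J *m rho *m V ^t*) - rtr (V ^t* *m tau *m V) - s * rtr (V *m rho *m V ^t*).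

Definition pair_resolvent s :=
  resolvent_sum pair_weight (fun ji => la ji.2) (fun ji => mu ji.1) s.

Let adjG Y : (G ^t* *m Y *m E) ^t* = E ^t* *m Y ^t* *m G.
Proof. by rewrite !adjmxM trmxCK mulmxA. Qed.

(** In the two eigenbases the form has no cross terms, so maximizing it splits into one scalar
    problem per entry of [Y]. *)
Lemma pair_formE s (Y : 'M[C]_(m, n)) :
  pair_form s (G ^t* *m Y *m E) =
  \sum_j \sum_i (2 * complex.Re (X j i * Num.conj (Y j i)) * la i
     - (mu j + s * la i) * normc2 (Y j i)).
Proof.
rewrite /pair_form !adjG.
have EE : E *m E ^t* = 1%:M by apply/unitarymxP.
have GG : G *m G ^t* = 1%:M by apply/unitarymxP.
have -> : rtr (J *m rho *m (E ^t* *m Y ^t* *m G)) = rtr (X *m rdiag la *m Y ^t*).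
  rewrite [in LHS]mulmxA [LHS]rtr_mulC; congr rtr; rewrite /X /rho !mulmxA.
  by rewrite -(mulmxA _ E) EE mulmx1.
have -> : rtr (E ^t* *m Y ^t* *m G *m tau *m (G ^t* *m Y *m E))
        = rtr (Y ^t* *m rdiag mu *m Y ^t* ^t*).
  rewrite [in LHS]mulmxA [LHS]rtr_mulC trmxCK; congr rtr; rewrite /tau !mulmxA EE mul1mx.
  by rewrite -(mulmxA _ G (G ^t*)) GG mulmx1 -(mulmxA _ G (G ^t*)) GG mulmx1.
have -> : rtr (G ^t* *m Y *m E *m rho *m (E ^t* *m Y ^t* *m G))
        = rtr (Y *m rdiag la *m Y ^t*).
  rewrite [in LHS]mulmxA [LHS]rtr_mulC; congr rtr; rewrite /rho !mulmxA GG mul1mx.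
  by rewrite -(mulmxA _ E (E ^t*)) EE mulmx1 -(mulmxA _ E (E ^t*)) EE mulmx1.
rewrite !rtr_mul_diag_adj [X in _ - X - _]exchange_big /= !mulr_sumr -!sumrB.
apply: eq_bigr => j _; rewrite !mulr_sumr -!sumrB; apply: eq_bigr => i _.
rewrite !mxE /= Re_mul_conj normc2_conj Re_mul_conj; ring.
Qed.

Lemma pair_resolventE s : pair_resolvent s =
  \sum_j \sum_i normc2 (X j i) * la i * (la i / (mu j + s * la i)).
Proof. by rewrite pair_bigA. Qed.

(** The gap between the sides, multiplied by [b], is [|a x - b y|^2]. When [b = 0] also [a = 0], and
    both sides vanish. *)
Lemma complete_square (x y : C) (a b : R) : 0 <= b -> (b = 0 -> a = 0) ->
  2 * complex.Re (x * Num.conj y) * a - b * normc2 y <= normc2 x * a * (a / b).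
Proof.
move=> b0 ab; rewrite !normc2E.
have -> : complex.Re (x * Num.conj y)
    = complex.Re x * complex.Re y + complex.Im x * complex.Im y.
  by case: x y => ? ? [? ?] /=; ring.
case: (eqVneq b 0) => [bE|bN]; first by rewrite bE (ab bE) !(mulr0, mul0r) subrr.
have b1 : 0 < b by rewrite lt_neqAle eq_sym bN.
rewrite mulrA ler_pdivlMr//.
move: (complex.Re x) (complex.Re y) (complex.Im x) (complex.Im y) => p q r t.
have := sqr_ge0 (p * a - b * q); have := sqr_ge0 (r * a - b * t); lra.
Qed.

Let den_ge0 s j i : 0 < s -> 0 <= mu j + s * la i.
Proof. by move=> s0; rewrite addr_ge0// mulr_ge0// ltW. Qed.

Let den_eq0 s j i : 0 < s -> mu j + s * la i = 0 -> la i = 0.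
Proof.
move=> s0 /eqP; rewrite paddr_eq0 ?mulr_ge0//; last exact: ltW.
by move=> /andP[_]; rewrite mulf_eq0 gt_eqF//= => /eqP.
Qed.

Lemma pair_form_le s (V : 'M[C]_(m, n)) : 0 < s -> pair_form s V <= pair_resolvent s.
Proof.
move=> s0.
have -> : V = G ^t* *m (G *m V *m E ^t*) *m E.
  by rewrite !mulmxA (mul_adj_unitary Gu) mul1mx -mulmxA (mul_adj_unitary Eu) mulmx1.
rewrite pair_formE pair_resolventE.
apply: ler_sum => j _; apply: ler_sum => i _.
by apply: complete_square => [|/den_eq0]; [exact: den_ge0 | exact].
Qed.

Lemma pair_form_max s : 0 < s -> exists V, pair_form s V = pair_resolvent s.
Proof.
(* This is the equality case of [complete_square] in each entry. A zero denominator forces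
   [la i = 0], so the default quotient is harmless. *)
move=> s0; pose Y : 'M[C]_(m, n) :=
  \matrix_(j, i) (X j i * (la i / (mu j + s * la i))%:C).
exists (G ^t* *m Y *m E); rewrite pair_formE pair_resolventE.
apply: eq_bigr => j _; apply: eq_bigr => i _; rewrite !mxE.
have -> z a : complex.Re (z * Num.conj (z * a%:C)) = normc2 z * a.
  by rewrite rmorphM /= conjC_real_complex mulrA Re_mulr Re_mul_conj.
have -> z a : normc2 (z * a%:C) = normc2 z * a ^+ 2.
  by rewrite !normc2E; case: z => ? ? /=; ring.
have [d0|dN] := eqVneq (mu j + s * la i) 0.
  by rewrite d0 (den_eq0 s0 d0) !(mulr0, mul0r) subrr.
by field.
Qed.

Lemma pair_weight_ge0 ji : 0 <= pair_weight ji.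
Proof. by rewrite mulr_ge0// normc2_ge0. Qed.

(** If [G] diagonalizes [J rho J^*], the row sums are its eigenvalues; over a family of [J]
    resolving the identity, the column sums add up to the eigenvalues of [rho]. Hence a logarithm of
    a single eigenvalue sums to an entropy. *)
Lemma pair_weight_row j :
  \sum_i pair_weight (j, i) = complex.Re ((G *m (J *m rho *m J ^t*) *m G ^t*) j j).
Proof.
have -> : G *m (J *m rho *m J ^t*) *m G ^t* = X *m rdiag la *m X ^t*.
  by rewrite /X !adjmxM trmxCK /rho !mulmxA.
rewrite /pair_weight; move: X => Z; rewrite mxE Re_sum; apply: eq_bigr => i _.
by rewrite mul_mx_diag !mxE /= [in RHS]mulrAC Re_mulr Re_mul_conj.
Qed.

Lemma pair_weight_col i :
  \sum_j pair_weight (j, i) = complex.Re ((E *m (J ^t* *m J) *m E ^t*) i i) * la i.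
Proof.
have -> : E *m (J ^t* *m J) *m E ^t* = X ^t* *m X.
  rewrite /X !adjmxM trmxCK !mulmxA -(mulmxA _ (G ^t*) G) (mul_adj_unitary Gu).
  by rewrite mulmx1.
rewrite /pair_weight; move: X => Z; rewrite mxE Re_sum mulr_suml; apply: eq_bigr => j _.
by rewrite !mxE /= (mulrC (Num.conj _)) Re_mul_conj.
Qed.

End Pair.
End RealTrace.

(** * Entropy inequality for a pair of resolutions of the identity *)

Section Core.
Variable R : realType.
Local Notation C := R[i].

Lemma mulmx_sum_ortho (Q : finType) (a b m n : nat) (T : Q -> 'M[C]_(m, n))
    (A : Q -> 'M[C]_(a, m)) (B : Q -> 'M[C]_(m, b)) :
  (forall q q', T q *m (T q') ^t* = (q == q')%:R%:M) ->
  (\sum_q A q *m T q) *m (\sum_q (T q) ^t* *m B q) = \sum_q A q *m B q.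
Proof.
move=> TT; rewrite mulmx_suml; apply: eq_bigr => q _.
rewrite mulmx_sumr (bigD1 q)//= big1 ?addr0 => [|q' q'q].
  by rewrite mulmxA -(mulmxA (A q)) TT eqxx mulmx1.
by rewrite mulmxA -(mulmxA (A q)) TT eq_sym (negPf q'q) raddf0 mulmx0 mul0mx.
Qed.

Lemma psd_gram n (s : 'M[C]_n) : psdmx s -> exists M : 'M[C]_n, s = M *m M ^t*.
Proof.
move=> /psd_spectral[U [la [_ la0 ->]]].
pose D := rdiag (fun i => Num.sqrt (la i)).
have -> : rdiag la = D *m D ^t*.
  rewrite tr_diag_mx map_diag_mx mulmx_diag; congr diag_mx; apply/rowP => i.
  by rewrite !mxE /= conjC_real_complex -rmorphM /= -expr2 sqr_sqrtr.
by exists (U ^t* *m D); rewrite adjmxM trmxCK !mulmxA.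
Qed.

Lemma psd_conj m n (s : 'M[C]_n) (A : 'M[C]_(m, n)) :
  psdmx s -> psdmx (A *m s *m A ^t*).
Proof.
move=> /psd_gram[M ->].
have -> : A *m (M *m M ^t*) *m A ^t* = (A *m M) *m (A *m M) ^t*.
  by rewrite adjmxM !mulmxA.
exact: gram_psd.
Qed.

Lemma psd_rtr_ge0 m n (s : 'M[C]_n) (W : 'M[C]_(n, m)) :
  psdmx s -> 0 <= rtr (W ^t* *m s *m W).
Proof.
move=> [_ sP]; rewrite /rtr Re_sum; apply: sumr_ge0 => i _.
have := sP (col i W).
have -> : ((col i W) ^t* *m s *m col i W) 0 0 = (W ^t* *m s *m W) i i.
  rewrite !mxE; apply: eq_bigr => j _; rewrite !mxE; congr (_ * _).
  by apply: eq_bigr => k _; rewrite !mxE.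
by rewrite lecE => /andP[_].
Qed.

Lemma sum_xlog2 (I : finType) (x : I -> R) :
  ln 2 * (- \sum_i xlog2 (x i)) = - \sum_i x i * ln (x i).
Proof.
rewrite mulrN mulr_sumr; congr (- _); apply: eq_bigr => i _.
by rewrite /xlog2 /log2 mulrCA (mulrC (ln 2)) divfK// gt_eqF// ln_gt0// ltr1n.
Qed.

Lemma rtr_rdiag n (la : 'I_n -> R) (U : 'M[C]_n) : U \is unitarymx ->
  rtr (U ^t* *m rdiag la *m U) = \sum_i la i.
Proof.
move=> Uu; rewrite rtr_mulC mulmxA (unitarymxP Uu) mul1mx.
by rewrite /rtr mxtrace_diag Re_sum; apply: eq_bigr => i _; rewrite mxE.
Qed.

Lemma diag_entry n (la : 'I_n -> R) (U : 'M[C]_n) i : U \is unitarymx ->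
  complex.Re ((U *m (U ^t* *m rdiag la *m U) *m U ^t*) i i) = la i.
Proof.
move=> Uu; rewrite !mulmxA (unitarymxP Uu) mul1mx -mulmxA (unitarymxP Uu) mulmx1.
by rewrite !mxE eqxx.
Qed.

Lemma rtr_mulmx_scale m n (s : 'M[C]_m) (c : C) (Z : 'M[C]_(m, n)) :
  rtr (s *m ((c *: Z) *m (c *: Z) ^t*)) = normc2 c * rtr (Z ^t* *m s *m Z).
Proof.
have -> : (c *: Z) ^t* = Num.conj c *: Z ^t* by rewrite linearZ /= map_mxZ.
rewrite -scalemxAr -scalemxAl scalerA -scalemxAr mulrC -normc2_mulC rtrZ.
by congr (_ * _); rewrite mulmxA [LHS]rtr_mulC mulmxA.
Qed.

Lemma psd_sum n (Q : finType) (F : Q -> 'M[C]_n) :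
  (forall q, psdmx (F q)) -> psdmx (\sum_q F q).
Proof.
move=> FP; split.
  apply/is_hermitianmxP; rewrite expr0 scale1r adjmx_sum.
  apply: eq_bigr => q _; have [/is_hermitianmxP + _] := FP q.
  by rewrite expr0 scale1r.
move=> v; rewrite mulmx_sumr mulmx_suml summxE; apply: sumr_ge0 => q _.
by have [_] := FP q; apply.
Qed.

(* For a state of [A], [C] and the purifying system [D], these are
   [J k = <phi1_k| (x) 1], [T l x = <phi2_l| (x) 1 (x) <x|], [inj x = 1 (x) |x>]
   and [u k l = <phi1_k|phi2_l>], with [x] labelling a basis of [D]. *)
Variables (K L P : finType) (N p m : nat).
Variables (rho : 'M[C]_N) (J : K -> 'M[C]_(p, N)) (T : L -> P -> 'M[C]_(m, N)).
Variables (inj : P -> 'M[C]_(p, m)) (u : K -> L -> C) (kap : L -> R).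
Let r l := \sum_x T l x *m rho *m (T l x) ^t*.
Let sigma := \sum_l r l.
Hypothesis rho_psd : psdmx rho.
Hypothesis J_total : \sum_k (J k) ^t* *m J k = 1%:M.
Hypothesis T_total : \sum_l \sum_x (T l x) ^t* *m T l x = 1%:M.
Hypothesis T_ortho : forall l x l' x',
  T l x *m (T l' x') ^t* = ((l, x) == (l', x'))%:R%:M.
Hypothesis J_T : forall k l x, J k *m (T l x) ^t* = u k l *: inj x.
Hypothesis kap_gt0 : forall l, 0 < kap l.
Hypothesis u_kap : forall k l, normc2 (u k l) <= kap l.
Hypothesis J_sigma :
  \sum_k \sum_x (inj x) ^t* *m (J k *m rho *m (J k) ^t*) *m inj x = sigma.

Let tau k := J k *m rho *m (J k) ^t*.

Let r_psd l : psdmx (r l).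
Proof. by apply: psd_sum => x; apply: psd_conj. Qed.

(** Transport of test matrices by the adjoint of the measurement: in the setting above this is
    [\sum_l |phi2_l><phi2_l| (x) W l (x) 1]. *)
Let V (W : L -> 'M[C]_m) := \sum_(q : L * P) (T q.1 q.2) ^t* *m (W q.1 *m T q.1 q.2).

Let V_adj W : (V W) ^t* = \sum_(q : L * P) ((T q.1 q.2) ^t* *m (W q.1) ^t*) *m T q.1 q.2.
Proof.
by rewrite adjmx_sum; apply: eq_bigr => q _; rewrite !adjmxM trmxCK.
Qed.

Let TTo (q q' : L * P) : T q.1 q.2 *m (T q'.1 q'.2) ^t* = (q == q')%:R%:M.
Proof. by case: q q' => ? ? []*; apply: T_ortho. Qed.

Let V_linear W :
  \sum_k rtr (J k *m rho *m (J k *m V W) ^t*) = \sum_l rtr (r l *m (W l) ^t*).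
Proof.
transitivity (rtr (rho *m (V W) ^t*)).
  rewrite -[rho in RHS]mul1mx -J_total !mulmx_suml rtr_sum; apply: eq_bigr => k _.
  by rewrite adjmxM [in LHS]mulmxA [LHS]rtr_mulC !mulmxA.
rewrite V_adj mulmx_sumr rtr_sum.
rewrite -(pair_bigA _ (fun l x => rtr (rho *m ((T l x) ^t* *m (W l) ^t* *m T l x)))) /=.
apply: eq_bigr => l _; rewrite /r mulmx_suml rtr_sum; apply: eq_bigr => x _.
by rewrite [in LHS]mulmxA [LHS]rtr_mulC !mulmxA.
Qed.

(** Equality holds because the orthogonality of the [T l x] makes [V] multiplicative. *)
Let V_rho W :
  \sum_k rtr (J k *m V W *m rho *m (J k *m V W) ^t*)
  = \sum_l rtr (W l *m r l *m (W l) ^t*).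
Proof.
transitivity (rtr (rho *m ((V W) ^t* *m V W))).
  rewrite -[(V W) ^t* in RHS]mulmx1 -J_total !(mulmx_suml, mulmx_sumr) rtr_sum.
  apply: eq_bigr => k _.
  by rewrite adjmxM [LHS]rtr_mulC [RHS]rtr_mulC !mulmxA.
rewrite V_adj (mulmx_sum_ortho _ _ TTo) mulmx_sumr rtr_sum.
rewrite -(pair_bigA _ (fun l x =>
  rtr (rho *m ((T l x) ^t* *m (W l) ^t* *m (W l *m T l x))))) /=.
apply: eq_bigr => l _; rewrite [in RHS]rtr_mulC /r !(mulmx_suml, mulmx_sumr) rtr_sum.
by apply: eq_bigr => x _; rewrite !mulmxA -[in RHS](mulmxA _ rho) [RHS]rtr_mulC !mulmxA.
Qed.

(** The overlaps enter here: by [J_T] the blocks of [J k *m V W] carry coefficients [u k l], whose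
    squared moduli are bounded by [kap l], and [J_sigma] then adds up the blocks to [sigma]. *)
Let V_tau W :
  \sum_k rtr ((J k *m V W) ^t* *m tau k *m (J k *m V W))
  <= \sum_l kap l * rtr ((W l) ^t* *m sigma *m W l).
Proof.
have psd_t k l x : 0 <= rtr ((W l) ^t* *m ((inj x) ^t* *m tau k *m inj x) *m W l).
  rewrite (_ : _ *m _ = (inj x *m W l) ^t* *m tau k *m (inj x *m W l)).
    by apply: psd_rtr_ge0; apply: psd_conj.
  by rewrite adjmxM !mulmxA.
have JV k : J k *m V W = \sum_(q : L * P) (u k q.1 *: inj q.2 *m W q.1) *m T q.1 q.2.
  rewrite mulmx_sumr; apply: eq_bigr => q _.
  by rewrite mulmxA J_T mulmxA.
have JVa k : (J k *m V W) ^t*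
    = \sum_(q : L * P) (T q.1 q.2) ^t* *m (u k q.1 *: inj q.2 *m W q.1) ^t*.
  by rewrite JV adjmx_sum; apply: eq_bigr => q _; rewrite [LHS]adjmxM.
apply: (@le_trans _ _ (\sum_k \sum_l \sum_x
    kap l * rtr ((W l) ^t* *m ((inj x) ^t* *m tau k *m inj x) *m W l))).
  apply: ler_sum => k _; rewrite -mulmxA rtr_mulC -mulmxA.
  rewrite [X in _ *m X](_ : _ = \sum_(q : L * P)
     (u k q.1 *: inj q.2 *m W q.1) *m (u k q.1 *: inj q.2 *m W q.1) ^t*); last first.
    by rewrite JVa JV (mulmx_sum_ortho _ _ TTo).
  rewrite mulmx_sumr rtr_sum pair_bigA; apply: ler_sum => -[l x] _ /=.
  have -> : rtr (tau k *m (u k l *: inj x *m W l *m (u k l *: inj x *m W l) ^t*))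
      = normc2 (u k l) * rtr ((W l) ^t* *m ((inj x) ^t* *m tau k *m inj x) *m W l).
    by rewrite -scalemxAl rtr_mulmx_scale adjmxM !mulmxA.
  by apply: ler_wpM2r.
rewrite exchange_big; apply: ler_sum => l _ /=.
rewrite -J_sigma !(mulmx_suml, mulmx_sumr) rtr_sum mulr_sumr.
rewrite le_eqVlt; apply/orP; left; apply/eqP; apply: eq_bigr => k _.
by rewrite !(mulmx_suml, mulmx_sumr) rtr_sum mulr_sumr.
Qed.


(** Both sides become logarithmic sums over pair weights, with one pair [rho], [tau k] for each [k]
    and one pair [r l], [kap l] times [sigma] for each [l]. Only the resolvents summed over all
    pairs are comparable, so [resolvent_sum_le_log] is applied once to the joint index sets. *)
Theorem vN_entropy_uncertainty :
  vN_entropy sigma - \sum_l rtr (r l) * log2 (kap l)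
  <= \sum_k vN_entropy (tau k) - vN_entropy rho + \sum_l vN_entropy (r l).
Proof.
have [E [la [Eu la0 rhoE]]] := psd_spectral rho_psd.
have tau_psd k : psdmx (tau k) by apply: psd_conj.
have /choice[G /choice[mu GE]] := fun k => psd_spectral (tau_psd k).
have /choice[E' /choice[la' E'E]] := fun l => psd_spectral (r_psd l).
have [G' [mu' [G'u mu'0 sigmaE]]] := psd_spectral (psd_sum r_psd).
have Gu k : G k \is unitarymx by have [] := GE k.
have mu0 k j : 0 <= mu k j by have [] := GE k.
have tauE k : tau k = (G k) ^t* *m rdiag (mu k) *m G k by have [] := GE k.
have E'u l : E' l \is unitarymx by have [] := E'E l.
have la'0 l i : 0 <= la' l i by have [] := E'E l.
have rE l : r l = (E' l) ^t* *m rdiag (la' l) *m E' l by have [] := E'E l.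
pose w k := pair_weight E (G k) la (J k).
pose w' l := pair_weight (E' l) G' (la' l) 1%:M.
have w0 k ji : 0 <= w k ji by apply: pair_weight_ge0.
have w'0 l ji : 0 <= w' l ji by apply: pair_weight_ge0.
have w_row k j : \sum_i w k (j, i) = mu k j.
  rewrite /w pair_weight_row -rhoE -/(tau k) tauE; exact: diag_entry.
have w_col i : \sum_k \sum_j w k (j, i) = la i.
  rewrite /w; under eq_bigr do rewrite pair_weight_col//.
  rewrite -mulr_suml -Re_sum -summxE -mulmx_suml -mulmx_sumr J_total mulmx1.
  by rewrite (unitarymxP Eu) mxE eqxx mul1r.
have w'_row j : \sum_l \sum_i w' l (j, i) = mu' j.
  rewrite /w'; under eq_bigr do rewrite pair_weight_row -rE mul1mx adjmx1 mulmx1.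
  rewrite -Re_sum -summxE -mulmx_suml -mulmx_sumr sigmaE; exact: diag_entry.
have w'_col l i : \sum_j w' l (j, i) = la' l i.
  rewrite /w' pair_weight_col// adjmx1 !mulmx1 (unitarymxP (E'u l)).
  by rewrite mxE eqxx mul1r.
have tr_r l : rtr (r l) = \sum_i la' l i by rewrite rE rtr_rdiag.
(* The eigenvalue [la i] is a factor of the weight, and [mu k j] is a sum of nonnegative weights
   that includes it. *)
have w_supp k j i : w k (j, i) != 0 -> 0 < la i /\ 0 < mu k j.
  move=> wN; split; rewrite lt_neqAle ?la0 ?mu0 andbT eq_sym; apply: contra wN => /eqP z.
    by rewrite /w /pair_weight /= z mulr0.
  move: (w_row k j); rewrite z => /eqP; rewrite psumr_eq0//.
  by move=> /allP/(_ i (mem_index_enum _))/=.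
have w'_supp l j i : w' l (j, i) != 0 -> 0 < la' l i /\ 0 < mu' j.
  move=> wN; split; rewrite lt_neqAle ?la'0 ?mu'0 andbT eq_sym; apply: contra wN => /eqP z.
    by rewrite /w' /pair_weight /= z mulr0.
  move: (w'_row j); rewrite z => /eqP.
  rewrite psumr_eq0 => [/allP/(_ l (mem_index_enum _))/=|l' _]; last exact: sumr_ge0.
  by rewrite psumr_eq0// => /allP/(_ i (mem_index_enum _))/=.
have key : \sum_(q : L * ('I_m * 'I_m))
      w' q.1 q.2 * (ln (la' q.1 q.2.2) - ln (kap q.1 * mu' q.2.1))
    <= \sum_(q : K * ('I_p * 'I_N)) w q.1 q.2 * (ln (la q.2.2) - ln (mu q.1 q.2.1)).
  apply: (@resolvent_sum_le_log R (K * ('I_p * 'I_N))%type (L * ('I_m * 'I_m))%type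
    (fun q => w q.1 q.2) (fun q => la q.2.2) (fun q => mu q.1 q.2.1)
    (fun q => w' q.1 q.2) (fun q => la' q.1 q.2.2) (fun q => kap q.1 * mu' q.2.1)).
  - by move=> q.
  - by move=> [k [j i]]; apply: w_supp.
  - by move=> q.
  - by move=> [l [j i]] /w'_supp[? ?]; rewrite mulr_gt0.
  - rewrite -(pair_bigA _ (fun k ji => w k ji)) -(pair_bigA _ (fun l ji => w' l ji)) /=.
    (* Both total weights are the trace of [rho], through [J_total] on one side and [T_total] on the
       other. *)
    transitivity (rtr rho).
      rewrite rhoE rtr_rdiag// -(eq_bigr _ (fun i _ => w_col i)) [RHS]exchange_big /=.
      by apply: eq_bigr => k _; rewrite [RHS]exchange_big pair_bigA; apply: eq_bigr => -[].
    transitivity (\sum_l rtr (r l)).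
      rewrite -[rho]mulmx1 -T_total mulmx_sumr rtr_sum; apply: eq_bigr => l _.
      rewrite mulmx_sumr !rtr_sum; apply: eq_bigr => x _.
      by rewrite mulmxA [LHS]rtr_mulC mulmxA.
    apply: eq_bigr => l _; rewrite tr_r -(eq_bigr _ (fun i _ => w'_col l i)).
    rewrite [LHS]exchange_big /=.
    by rewrite pair_bigA; apply: eq_bigr => -[].
  - move=> s s0.
    (* The [W l] are optimal on the measured side. Their transport need not be optimal on the other
       side, where any test matrix yields a lower bound. *)
    have /choice[W WE] := fun l => pair_form_max 1%:M (E'u l) G'u (la'0 l)
      (fun j => mulr_ge0 (ltW (kap_gt0 l)) (mu'0 j)) s0.
    rewrite /resolvent_sum -(pair_bigA _ (fun l ji =>
      w' l ji * (la' l ji.2 / (kap l * mu' ji.1 + s * la' l ji.2)))).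
    rewrite -(pair_bigA _ (fun k ji =>
      w k ji * (la ji.2 / (mu k ji.1 + s * la ji.2)))) /=.
    rewrite -(eq_bigr _ (fun l _ => WE l)).
    apply: (@le_trans _ _
      (\sum_k pair_form E (G k) la (mu k) (J k) s (J k *m V W))); last first.
      by apply: ler_sum => k _; apply: pair_form_le.
    have form' l : pair_form (E' l) G' (la' l) (fun j => kap l * mu' j) 1%:M s (W l) =
        2 * rtr (r l *m (W l) ^t*) - kap l * rtr ((W l) ^t* *m sigma *m W l)
        - s * rtr (W l *m r l *m (W l) ^t*).
      rewrite /pair_form -rE mul1mx; congr (_ - _ - _).
      rewrite -rtrZ scalemxAl scalemxAr; congr (rtr (_ *m _ *m _)).
      rewrite [sigma]sigmaE scalemxAl scalemxAr; congr (_ *m _ *m _).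
      by apply/matrixP => a b; rewrite !mxE; case: (a == b); rewrite ?mulr0// rmorphM.
    rewrite (eq_bigr _ (fun l _ => form' l)) /pair_form -rhoE !sumrB -!mulr_sumr.
    under [X in _ <= _ - X - _]eq_bigr do rewrite -tauE.
    rewrite V_linear V_rho; have := V_tau W; lra.
move: key; under eq_bigr do rewrite mulrBr; under [X in _ <= X]eq_bigr do rewrite mulrBr.
rewrite !sumrB -(pair_bigA _ (fun l ji => w' l ji * ln (la' l ji.2)))
  -(pair_bigA _ (fun l ji => w' l ji * ln (kap l * mu' ji.1)))
  -(pair_bigA _ (fun k ji => w k ji * ln (la ji.2)))
  -(pair_bigA _ (fun k ji => w k ji * ln (mu k ji.1))) /=.
(* Summing the weights over the indices absent from the logarithm leaves entropy sums, here and in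
   the next three rewrites. *)
have -> : \sum_k \sum_ji w k ji * ln (la ji.2) = \sum_i la i * ln (la i).
  under [RHS]eq_bigr do rewrite -{1}w_col mulr_suml.
  rewrite [RHS]exchange_big /=; apply: eq_bigr => k _.
  under [RHS]eq_bigr do rewrite mulr_suml.
  by rewrite [RHS]exchange_big pair_bigA; apply: eq_bigr => -[].
have -> : \sum_k \sum_ji w k ji * ln (mu k ji.1) = \sum_k \sum_j mu k j * ln (mu k j).
  apply: eq_bigr => k _; under [RHS]eq_bigr do rewrite -{1}w_row mulr_suml.
  by rewrite pair_bigA; apply: eq_bigr => -[].
have -> : \sum_l \sum_ji w' l ji * ln (la' l ji.2) = \sum_l \sum_i la' l i * ln (la' l i).
  apply: eq_bigr => l _; under [RHS]eq_bigr do rewrite -{1}w'_col mulr_suml.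
  by rewrite [RHS]exchange_big pair_bigA; apply: eq_bigr => -[].
have -> : \sum_l \sum_ji w' l ji * ln (kap l * mu' ji.1)
    = \sum_l rtr (r l) * ln (kap l) + \sum_j mu' j * ln (mu' j).
  have -> : \sum_j mu' j * ln (mu' j) = \sum_l \sum_ji w' l ji * ln (mu' ji.1).
    under eq_bigr do rewrite -{1}w'_row mulr_suml.
    rewrite exchange_big /=; apply: eq_bigr => l _.
    under eq_bigr do rewrite mulr_suml.
    by rewrite pair_bigA; apply: eq_bigr => -[].
  rewrite -big_split /=; apply: eq_bigr => l _.
  rewrite tr_r -(eq_bigr _ (fun i _ => w'_col l i)).
  rewrite exchange_big pair_bigA mulr_suml -big_split /=; apply: eq_bigr => -[j i] _ /=.
  have [->|/w'_supp[_ m0]] := eqVneq (w' l (j, i)) 0; first by rewrite !mul0r addr0.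
  by rewrite lnM ?posrE// mulrDr.
have ln2 : 0 < ln 2 :> R by rewrite ln_gt0// ltr1n.
have vN n (U : 'M[C]_n) l : U \is unitarymx ->
    ln 2 * vN_entropy (U ^t* *m rdiag l *m U) = - \sum_i l i * ln (l i).
  by move=> Uu; rewrite vN_entropy_diag// sum_xlog2.
have e1 : ln 2 * vN_entropy sigma = - \sum_j mu' j * ln (mu' j).
  by rewrite -(vN _ _ _ G'u) -sigmaE.
have e2 : ln 2 * vN_entropy rho = - \sum_i la i * ln (la i) by rewrite -(vN _ _ _ Eu) -rhoE.
have e3 : ln 2 * (\sum_k vN_entropy (tau k)) = - \sum_k \sum_j mu k j * ln (mu k j).
  by rewrite mulr_sumr -sumrN; apply: eq_bigr => k _; rewrite tauE vN.
have e4 : ln 2 * (\sum_l vN_entropy (r l)) = - \sum_l \sum_i la' l i * ln (la' l i).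
  by rewrite mulr_sumr -sumrN; apply: eq_bigr => l _; rewrite rE vN.
have e5 : ln 2 * (\sum_l rtr (r l) * log2 (kap l)) = \sum_l rtr (r l) * ln (kap l).
  rewrite mulr_sumr; apply: eq_bigr => l _.
  by rewrite /log2 mulrCA (mulrC (ln 2)) divfK// gt_eqF.
move=> key; rewrite -(ler_pM2l ln2) mulrBr mulrDr mulrBr e1 e2 e3 e4 e5.
by move: key; lra.
Qed.
End Core.

(** * Partial inner products and measured states *)

Section Blocks.
Variable R : realType.
Local Notation C := R[i].

Lemma big_mxtens (V : nmodType) m n (F : 'I_(m * n) -> V) :
  \sum_i F i = \sum_a \sum_x F (mxtens_index (a, x)).
Proof.
rewrite pair_bigA (reindex (@mxtens_index m n)) /=.
  by apply: eq_bigr => -[].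
by exists (@mxtens_unindex m n) => i _; rewrite (mxtens_indexK, mxtens_unindexK).
Qed.

Lemma sum_delta (I : finType) (F : I -> C) i :
  \sum_j F j * (i == j)%:R = F i.
Proof.
rewrite (bigD1 i)//= eqxx mulr1 big1 ?addr0// => j /negPf ji.
by rewrite eq_sym ji mulr0.
Qed.

(** A left inverse of the square matrix with columns [phi k] is also a right inverse. *)
Lemma orthonormal_complete d (phi : 'I_d -> 'cV[C]_d) : orthonormal_basis phi ->
  forall a b, \sum_k phi k a 0 * Num.conj (phi k b 0) = (a == b)%:R.
Proof.
move=> phiP a b; pose F : 'M[C]_d := \matrix_(a, k) phi k a 0.
have /mulmx1C FF : F ^t* *m F = 1%:M.
  apply/matrixP => k l; have := phiP k l => /matrixP/(_ 0 0).
  rewrite !mxE eqxx mulr1n => <-; apply: eq_bigr => x _; by rewrite !mxE.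
have := congr1 (fun M : 'M_d => M a b) FF; rewrite !mxE => <-.
by apply: eq_bigr => k _; rewrite !mxE.
Qed.

(* [<phi_k| (x) 1] *)
Definition bra_tens d n (phi : 'I_d -> 'cV[C]_d) k : 'M[C]_(n, d * n) :=
  \matrix_(x, i) (Num.conj (phi k (mxtens_unindex i).1 0) * (x == (mxtens_unindex i).2)%:R).

Lemma bra_tensE d n (phi : 'I_d -> 'cV[C]_d) k (x : 'I_n) a y :
  bra_tens n phi k x (mxtens_index (a, y)) = Num.conj (phi k a 0) * (x == y)%:R.
Proof. by rewrite mxE mxtens_indexK. Qed.

Lemma bra_tens_mul d n p (phi : 'I_d -> 'cV[C]_d) k (s : 'M[C]_(d * n, p)) x y :
  (bra_tens n phi k *m s) x y =
  \sum_a Num.conj (phi k a 0) * s (mxtens_index (a, x)) y.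
Proof.
rewrite mxE big_mxtens; apply: eq_bigr => a _.
under eq_bigr do rewrite bra_tensE mulrAC.
by rewrite sum_delta.
Qed.

Lemma bra_tens_cross d n (phi psi : 'I_d -> 'cV[C]_d) k l :
  bra_tens n phi k *m (bra_tens n psi l) ^t* = (((phi k) ^t* *m psi l) 0 0)%:M.
Proof.
apply/matrixP => x y; rewrite bra_tens_mul !mxE.
under eq_bigr => a _.
  rewrite adjmxE bra_tensE rmorphM /= conjCK rmorph_nat mulrA; over.
rewrite -mulr_suml eq_sym -[RHS]mulr_natr; congr (_ * _).
by apply: eq_bigr => a _; rewrite !mxE.
Qed.

Lemma bra_tens_ortho d n (phi : 'I_d -> 'cV[C]_d) k l : orthonormal_basis phi ->
  bra_tens n phi k *m (bra_tens n phi l) ^t* = (k == l)%:R%:M.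
Proof. by move=> phiP; rewrite bra_tens_cross phiP !mxE. Qed.

Lemma proj_tens d n (phi : 'I_d -> 'cV[C]_d) k :
  proj (phi k) *t (1%:M : 'M[C]_n) = (bra_tens n phi k) ^t* *m bra_tens n phi k.
Proof.
apply/matrixP => i j; case: (mxtens_indexP i) => a x; case: (mxtens_indexP j) => b y.
rewrite tensmxE [RHS]mxE.
under eq_bigr => z _.
  rewrite adjmxE !bra_tensE rmorphM /= conjCK rmorph_nat.
  rewrite mulrACA -natrM mulnb; over.
rewrite -mulr_sumr !mxE big_ord1 !mxE; congr (_ * _).
rewrite (bigD1 x)//= eqxx big1 ?addr0 => [|z /negPf ->]; last by [].
by rewrite eq_sym.
Qed.

Lemma bra_tens_total d n (phi : 'I_d -> 'cV[C]_d) : orthonormal_basis phi ->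
  \sum_k (bra_tens n phi k) ^t* *m bra_tens n phi k = 1%:M.
Proof.
move=> phiP; under eq_bigr do rewrite -proj_tens.
apply/matrixP => i j; case: (mxtens_indexP i) => a x; case: (mxtens_indexP j) => b y.
rewrite summxE; under eq_bigr => k _.
  rewrite tensmxE mxE big_ord1 !mxE /=; over.
rewrite -mulr_suml orthonormal_complete// !mxE.
rewrite -natrM mulnb (inj_eq (can_inj (@mxtens_indexK _ _))) -pair_eqE.
by [].
Qed.

Definition ptrace1 d n (s : 'M[C]_(d * n)) : 'M[C]_n :=
  \matrix_(x, y) \sum_a s (mxtens_index (a, x)) (mxtens_index (a, y)).

Lemma bra_tens_block d n (phi : 'I_d -> 'cV[C]_d) k (s : 'M[C]_(d * n)) x y :
  (bra_tens n phi k *m s *m (bra_tens n phi k) ^t*) x y =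
  \sum_a \sum_b phi k b 0 * Num.conj (phi k a 0) *
    s (mxtens_index (a, x)) (mxtens_index (b, y)).
Proof.
rewrite -mulmxA bra_tens_mul; apply: eq_bigr => a _.
have -> : s *m (bra_tens n phi k) ^t* = (bra_tens n phi k *m s ^t*) ^t*.
  by rewrite adjmxM trmxCK.
rewrite adjmxE bra_tens_mul rmorph_sum mulr_sumr; apply: eq_bigr => b _.
by rewrite rmorphM /= conjCK adjmxE conjCK; ring.
Qed.

Lemma sum_bra_tens_block d n (phi : 'I_d -> 'cV[C]_d) (s : 'M[C]_(d * n)) :
  orthonormal_basis phi ->
  \sum_k bra_tens n phi k *m s *m (bra_tens n phi k) ^t* = ptrace1 s.
Proof.
move=> phiP; apply/matrixP => x y; rewrite summxE mxE.
under eq_bigr do rewrite bra_tens_block.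
rewrite exchange_big; apply: eq_bigr => a _.
rewrite exchange_big /=.
rewrite -[RHS](sum_delta (fun b => s (mxtens_index (a, x)) (mxtens_index (b, y))) a).
apply: eq_bigr => b _; rewrite -mulr_suml orthonormal_complete// mulrC.
by rewrite eq_sym.
Qed.

(** The measured state is block diagonal along [phi], so tensoring each [phi k] with an eigenbasis
    of its block gives an eigenbasis of the whole; the rows of [U] are the corresponding bras. *)
Lemma vN_entropy_meas_state d n (phi : 'I_d -> 'cV[C]_d) (s : 'M[C]_(d * n)) :
  orthonormal_basis phi -> psdmx s ->
  vN_entropy (meas_state phi s) =
  \sum_k vN_entropy (bra_tens n phi k *m s *m (bra_tens n phi k) ^t*).
Proof.
move=> phiP sP.
have /choice[G /choice[mu GE]] := fun k => psd_spectral (psd_conj (bra_tens n phi k) sP).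
pose U : 'M[C]_(d * n) := \matrix_(i, j)
  (G (mxtens_unindex i).1 *m bra_tens n phi (mxtens_unindex i).1) (mxtens_unindex i).2 j.
pose nu (i : 'I_(d * n)) := mu (mxtens_unindex i).1 (mxtens_unindex i).2.
have UE k x j : U (mxtens_index (k, x)) j = (G k *m bra_tens n phi k) x j.
  by rewrite mxE mxtens_indexK.
have Uu : U \is unitarymx.
  apply/unitarymxP/matrixP => i j.
  case: (mxtens_indexP i) => k x; case: (mxtens_indexP j) => l y.
  transitivity ((G k *m bra_tens n phi k *m (G l *m bra_tens n phi l) ^t*) x y).
    rewrite mxE [RHS]mxE; apply: eq_bigr => z _.
    by rewrite UE; congr (_ * _); rewrite !adjmxE UE.
  rewrite adjmxM mulmxA -(mulmxA (G k)) bra_tens_ortho// mul_mx_scalar.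
  rewrite [RHS]mxE (inj_eq (can_inj (@mxtens_indexK _ _))) -pair_eqE /=.
  have [->|_] := eqVneq k l; last by rewrite scale0r mul0mx mxE.
  have [Gu _ _] := GE l; rewrite scale1r (unitarymxP Gu) mxE.
  by [].
have blockE k : (proj (phi k) *t 1%:M) *m s *m (proj (phi k) *t 1%:M)
    = (G k *m bra_tens n phi k) ^t* *m rdiag (mu k) *m (G k *m bra_tens n phi k).
  have [_ _ E] := GE k; rewrite !proj_tens adjmxM.
  transitivity ((bra_tens n phi k) ^t* *m
      (bra_tens n phi k *m s *m (bra_tens n phi k) ^t*) *m bra_tens n phi k).
    by rewrite !mulmxA.
  by rewrite E !mulmxA.
have -> : meas_state phi s = U ^t* *m rdiag nu *m U.
  rewrite /meas_state; under eq_bigr do rewrite blockE.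
  apply/matrixP => i j; rewrite summxE [RHS]mxE big_mxtens; apply: eq_bigr => k _.
  rewrite mxE; apply: eq_bigr => x _; rewrite UE; congr (_ * _).
  by rewrite !mul_mx_diag mxE [RHS]mxE !adjmxE UE !mxE /nu !mxtens_indexK.
rewrite vN_entropy_diag// big_mxtens -sumrN; apply: eq_bigr => k _.
have [Gu _ ->] := GE k; rewrite vN_entropy_diag//; congr (- _).
by apply: eq_bigr => x _; rewrite /nu !mxtens_indexK.
Qed.

End Blocks.

(** * Uncertainty relations with and without memory *)

Section Uncertainty.
Variable R : realType.
Local Notation C := R[i].

Definition ptrace2 d n (s : 'M[C]_(d * n)) : 'M[C]_d :=
  \matrix_(a, b) \sum_x s (mxtens_index (a, x)) (mxtens_index (b, x)).

Lemma meas_probE d (phi : 'I_d -> 'cV[C]_d) (s : 'M[C]_d) k :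
  meas_prob phi s k = complex.Re (\sum_a \sum_b phi k b 0 * Num.conj (phi k a 0) * s a b).
Proof.
rewrite /meas_prob mxE; congr complex.Re; rewrite exchange_big; apply: eq_bigr => b _.
rewrite mxE mulr_suml; apply: eq_bigr => a _; rewrite !adjmxE; ring.
Qed.

Lemma rtr_bra_tens_block d n (phi : 'I_d -> 'cV[C]_d) k (s : 'M[C]_(d * n)) :
  rtr (bra_tens n phi k *m s *m (bra_tens n phi k) ^t*) = meas_prob phi (ptrace2 s) k.
Proof.
rewrite /rtr meas_probE; congr complex.Re.
rewrite /mxtrace; under eq_bigr do rewrite bra_tens_block.
rewrite exchange_big; apply: eq_bigr => a _; rewrite exchange_big; apply: eq_bigr => b _.
by rewrite mxE mulr_sumr.
Qed.

Section Tripartite.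
(** [G] holds the amplitudes of a pure vector on [A], [X], [Y] and a purifying system [D]. The names
    [X] and [Y] stand for [B] and [C] in either order. *)
Variables (dA dX dY D : nat) (G : 'I_dA -> 'I_dX -> 'I_dY -> 'I_D -> C).
Variables (phi1 phi2 : 'I_dA -> 'cV[C]_dA).
Hypotheses (phi1P : orthonormal_basis phi1) (phi2P : orthonormal_basis phi2).

Definition margin_AX : 'M[C]_(dA * dX) := \matrix_(i, j) \sum_y \sum_n
  G (mxtens_unindex i).1 (mxtens_unindex i).2 y n *
  Num.conj (G (mxtens_unindex j).1 (mxtens_unindex j).2 y n).
Definition margin_AY : 'M[C]_(dA * dY) := \matrix_(i, j) \sum_x \sum_n
  G (mxtens_unindex i).1 x (mxtens_unindex i).2 n *
  Num.conj (G (mxtens_unindex j).1 x (mxtens_unindex j).2 n).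

(** The pure vector reshaped across the cut between [A Y D] and [X], so that [Z *m Z ^t*] is its
    marginal on [A Y D]. *)
Let Z : 'M[C]_(dA * (dY * D), dX) := \matrix_(i, x)
  G (mxtens_unindex i).1 x (mxtens_unindex (mxtens_unindex i).2).1
    (mxtens_unindex (mxtens_unindex i).2).2.

Let ZE a y n x : Z (mxtens_index (a, mxtens_index (y, n))) x = G a x y n.
Proof. by rewrite mxE !mxtens_indexK. Qed.

Let J k : 'M[C]_(dY * D, dA * (dY * D)) := bra_tens (dY * D) phi1 k.

Definition ket_tens (n : 'I_D) : 'M[C]_(dY * D, dY) :=
  \matrix_(i, y) (((mxtens_unindex i).1 == y) && ((mxtens_unindex i).2 == n))%:R.

Lemma ket_tens_mul m n (s : 'M[C]_(dY * D, m)) y j :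
  ((ket_tens n) ^t* *m s) y j = s (mxtens_index (y, n)) j.
Proof.
rewrite mxE big_mxtens (bigD1 y)//= (bigD1 n)//= adjmxE mxE mxtens_indexK !eqxx.
rewrite rmorph1 mul1r big1 ?addr0 => [|n' /negPf n'n]; last first.
  by rewrite adjmxE mxE mxtens_indexK /= n'n andbF rmorph0 mul0r.
rewrite big1 ?addr0// => y' /negPf y'y; rewrite big1// => n' _.
by rewrite adjmxE mxE mxtens_indexK /= y'y rmorph0 mul0r.
Qed.

Lemma ket_tens_ortho n n' : (ket_tens n) ^t* *m ket_tens n' = (n == n')%:R%:M.
Proof.
apply/matrixP => y y'; rewrite ket_tens_mul !mxE mxtens_indexK /=.
by case: eqVneq; case: eqVneq.
Qed.

Lemma ket_tens_total : \sum_n ket_tens n *m (ket_tens n) ^t* = 1%:M.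
Proof.
apply/matrixP => i j; case: (mxtens_indexP i) => y n; case: (mxtens_indexP j) => y' n'.
rewrite summxE; under eq_bigr => k _.
  rewrite mxE; under eq_bigr => z _.
    rewrite adjmxE !mxE !mxtens_indexK /= rmorph_nat -natrM mulnb; over.
  over.
rewrite (bigD1 n)//= (bigD1 y)//= big1 ?addr0 => [|z /negPf zy]; last first.
  by rewrite eq_sym zy.
rewrite big1 ?addr0 => [|k /negPf kn]; last first.
  by rewrite big1// => z _; rewrite [n == k]eq_sym kn andbF.
rewrite !eqxx mxE (inj_eq (can_inj (@mxtens_indexK _ _))) -pair_eqE /=.
by rewrite [y' == y]eq_sym [n' == n]eq_sym.
Qed.

Lemma margin_AX_psd : psdmx margin_AX.
Proof.
pose M : 'M[C]_(dA * dX, dY * D) := \matrix_(i, j)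
  G (mxtens_unindex i).1 (mxtens_unindex i).2 (mxtens_unindex j).1 (mxtens_unindex j).2.
have -> : margin_AX = M *m M ^t*; last exact: gram_psd.
apply/matrixP => i j; rewrite !mxE big_mxtens; apply: eq_bigr => y _.
by apply: eq_bigr => n _; rewrite adjmxE !mxE !mxtens_indexK.
Qed.

Lemma margin_AY_psd : psdmx margin_AY.
Proof.
pose M : 'M[C]_(dA * dY, dX * D) := \matrix_(i, j)
  G (mxtens_unindex i).1 (mxtens_unindex j).1 (mxtens_unindex i).2 (mxtens_unindex j).2.
have -> : margin_AY = M *m M ^t*; last exact: gram_psd.
apply/matrixP => i j; rewrite !mxE big_mxtens; apply: eq_bigr => y _.
by apply: eq_bigr => n _; rewrite adjmxE !mxE !mxtens_indexK.
Qed.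

Let T l n : 'M[C]_(dY, dA * (dY * D)) := (ket_tens n) ^t* *m bra_tens (dY * D) phi2 l.

Let T_mul l n m (s : 'M[C]_(_, m)) y j : (T l n *m s) y j =
  \sum_a Num.conj (phi2 l a 0) * s (mxtens_index (a, mxtens_index (y, n))) j.
Proof. by rewrite -mulmxA ket_tens_mul bra_tens_mul. Qed.

Lemma vN_entropy_AYD : vN_entropy (Z *m Z ^t*) = vN_entropy (ptrace1 margin_AX).
Proof.
rewrite vN_entropy_gram; congr vN_entropy; apply/matrixP => x x'.
rewrite mxE [LHS]mxE !mxE big_mxtens; apply: eq_bigr => a _.
rewrite big_mxtens !mxE !mxtens_indexK; apply: eq_bigr => y _; apply: eq_bigr => n _.
by rewrite adjmxE !ZE mulrC.
Qed.

(** After outcome [k] the vector [J k *m Z] is still pure between [Y D] and [X], so its two reduced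
    states have equal entropy. *)
Lemma vN_entropy_AYD_block k :
  vN_entropy (J k *m (Z *m Z ^t*) *m (J k) ^t*) =
  vN_entropy (bra_tens dX phi1 k *m margin_AX *m (bra_tens dX phi1 k) ^t*).
Proof.
have -> : J k *m (Z *m Z ^t*) *m (J k) ^t* = (J k *m Z) *m (J k *m Z) ^t*.
  by rewrite adjmxM !mulmxA.
rewrite vN_entropy_gram; congr vN_entropy; apply/matrixP => x x'.
rewrite bra_tens_block mxE mxE big_mxtens.
under eq_bigr => y _.
  under eq_bigr => n _.
    rewrite adjmxE !bra_tens_mul rmorph_sum big_distrlr /=; over.
  over.
under eq_bigr do rewrite exchange_big; rewrite exchange_big [RHS]exchange_big /=.
apply: eq_bigr => b _.
under eq_bigr do rewrite exchange_big; rewrite exchange_big /=.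
apply: eq_bigr => a _; rewrite mxE !mxtens_indexK !mulr_sumr; apply: eq_bigr => y _.
rewrite mulr_sumr; apply: eq_bigr => n _.
by rewrite !ZE rmorphM /= conjCK; ring.
Qed.

(** The core inequality is applied to the marginal on [A Y D]; purity moves the entropies of that
    marginal and of its [phi1] blocks to [X]. *)
Lemma vN_entropy_tripartite (kap : 'I_dA -> R) :
  (forall l, 0 < kap l) -> (forall k l, overlap phi1 phi2 k l <= kap l) ->
  - \sum_l meas_prob phi2 (ptrace2 margin_AY) l * log2 (kap l) <=
  cond_entropy phi1 margin_AX (ptrace1 margin_AX) +
  cond_entropy phi2 margin_AY (ptrace1 margin_AY).
Proof.
move=> kap0 kapP.
pose r l := \sum_n T l n *m (Z *m Z ^t*) *m (T l n) ^t*.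
have rE l : r l = bra_tens dY phi2 l *m margin_AY *m (bra_tens dY phi2 l) ^t*.
  apply/matrixP => y y'; rewrite bra_tens_block summxE.
  under eq_bigr => n _.
    have -> : T l n *m (Z *m Z ^t*) *m (T l n) ^t* = (T l n *m Z) *m (T l n *m Z) ^t*.
      by rewrite adjmxM !mulmxA.
    rewrite mxE; under eq_bigr do rewrite adjmxE !T_mul rmorph_sum big_distrlr /=.
    rewrite exchange_big /=; under eq_bigr do rewrite exchange_big /=; over.
  rewrite /= exchange_big; apply: eq_bigr => a _.
  rewrite /= exchange_big; apply: eq_bigr => b _.
  rewrite mxE !mxtens_indexK mulr_sumr exchange_big; apply: eq_bigr => x _.
  rewrite mulr_sumr; apply: eq_bigr => n _.
  by rewrite !ZE rmorphM /= conjCK; ring.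
have sigmaE : \sum_l r l = ptrace1 margin_AY.
  by under eq_bigr do rewrite rE; apply: sum_bra_tens_block.
have : vN_entropy (ptrace1 margin_AY) - \sum_l rtr (r l) * log2 (kap l) <=
    \sum_k vN_entropy (J k *m (Z *m Z ^t*) *m (J k) ^t*) - vN_entropy (Z *m Z ^t*)
    + \sum_l vN_entropy (r l).
  rewrite -sigmaE; apply: (@vN_entropy_uncertainty R 'I_dA 'I_dA 'I_D
    _ _ _ _ J T ket_tens (fun k l => ((phi1 k) ^t* *m phi2 l) 0 0)) => //.
  - exact: gram_psd.
  - exact: bra_tens_total.
  - under eq_bigr => l _.
      under eq_bigr => n _.
        rewrite adjmxM trmxCK mulmxA -(mulmxA _ (ket_tens n)); over.
      rewrite -mulmx_suml -mulmx_sumr ket_tens_total mulmx1; over.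
    exact: bra_tens_total.
  - move=> l x l' x'; rewrite adjmxM trmxCK mulmxA -(mulmxA _ _ (bra_tens _ _ _ ^t*)).
    rewrite bra_tens_ortho// -scalemx1 -scalemxAr mulmx1 -scalemxAl ket_tens_ortho.
    by rewrite -pair_eqE /= scale_scalar_mx -natrM mulnb.
  - by move=> k l x; rewrite adjmxM trmxCK mulmxA bra_tens_cross mul_scalar_mx.
  (* The trace over [A] is the same in both bases, which exchanges [phi1] for [phi2]; the sum over
     [x] traces out [D]. *)
  - transitivity (\sum_x (ket_tens x) ^t* *m ptrace1 (Z *m Z ^t*) *m ket_tens x).
      rewrite exchange_big; apply: eq_bigr => x _.
      by rewrite -mulmx_suml -mulmx_sumr sum_bra_tens_block.
    rewrite exchange_big; apply: eq_bigr => x _.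
    rewrite -(sum_bra_tens_block (Z *m Z ^t*) phi2P) mulmx_sumr mulmx_suml.
    by apply: eq_bigr => l _; rewrite adjmxM trmxCK !mulmxA.
rewrite vN_entropy_AYD (eq_bigr _ (fun k _ => vN_entropy_AYD_block k)).
rewrite -vN_entropy_meas_state//; last exact: margin_AX_psd.
have -> : \sum_l vN_entropy (r l) = vN_entropy (meas_state phi2 margin_AY).
  rewrite vN_entropy_meas_state//; last exact: margin_AY_psd.
  by apply: eq_bigr => l _; rewrite rE.
under [X in _ - X <= _]eq_bigr do rewrite rE rtr_bra_tens_block.
rewrite /cond_entropy; lra.
Qed.
End Tripartite.

Lemma orthonormal_total d (phi : 'I_d -> 'cV[C]_d) : orthonormal_basis phi ->
  \sum_k phi k *m (phi k) ^t* = 1%:M.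
Proof.
move=> phiP; apply/matrixP => a b; rewrite summxE mxE -(orthonormal_complete phiP).
by apply: eq_bigr => k _; rewrite mxE big_ord1 adjmxE.
Qed.

Lemma vN_entropy1 (s : 'M[C]_1) : psdmx s -> vN_entropy s = - xlog2 (complex.Re (s 0 0)).
Proof.
move=> /psd_spectral[U [la [Uu _ ->]]]; rewrite vN_entropy_diag// big_ord1.
have -> : rdiag la = (la 0)%:C%:M.
  by apply/matrixP => i j; rewrite !mxE !ord1.
by rewrite mul_mx_scalar -scalemxAl mul_adj_unitary// !mxE eqxx mulr1.
Qed.

(** The core inequality with one-dimensional [C] and [D]: all blocks are numbers, their entropies
    are the terms of Shannon entropies, and [sigma] is the number 1, of entropy zero. *)
Lemma shannon_uncertainty d (s : 'M[C]_d) (phi1 phi2 : 'I_d -> 'cV[C]_d) (kap : 'I_d -> R) :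
  density_mx s -> orthonormal_basis phi1 -> orthonormal_basis phi2 ->
  (forall l, 0 < kap l) -> (forall k l, overlap phi1 phi2 k l <= kap l) ->
  vN_entropy s - \sum_l meas_prob phi2 s l * log2 (kap l) <=
  shannonM phi1 s + shannonM phi2 s.
Proof.
move=> [sP tr1] phi1P phi2P kap0 kapP.
pose J k := (phi1 k) ^t*; pose T l (x : 'I_1) := (phi2 l) ^t*.
pose r l := \sum_x T l x *m s *m (T l x) ^t*.
have rE l : r l = (phi2 l) ^t* *m s *m phi2 l by rewrite /r big_ord1 /T trmxCK.
have sum_block (phi : 'I_d -> 'cV[C]_d) : orthonormal_basis phi ->
    \sum_k (phi k) ^t* *m s *m phi k = 1%:M.
  move=> phiP; apply/matrixP => i j; rewrite !ord1 summxE mxE eqxx mulr1n -tr1.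
  rewrite -[s in RHS]mulmx1 -(orthonormal_total phiP) mulmx_sumr raddf_sum.
  by apply: eq_bigr => k _; rewrite /= mulmxA mxtrace_mulC mulmxA /mxtrace big_ord1.
have sigmaE : \sum_l r l = 1%:M by rewrite (eq_bigr _ (fun l _ => rE l)) sum_block.
have one_psd : psdmx (1%:M : 'M[C]_1).
  by rewrite -[1%:M]mulmx1 -{2}(adjmx1 _ 1); apply: gram_psd.
have block_psd (phi : 'I_d -> 'cV[C]_d) k : psdmx ((phi k) ^t* *m s *m phi k).
  by rewrite -{2}[phi k]trmxCK; apply: psd_conj.
have : vN_entropy (1%:M : 'M[C]_1) - \sum_l rtr (r l) * log2 (kap l) <=
    \sum_k vN_entropy (J k *m s *m (J k) ^t*) - vN_entropy s + \sum_l vN_entropy (r l).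
  rewrite -sigmaE; apply: (@vN_entropy_uncertainty R 'I_d 'I_d 'I_1 d 1 1
    s J T (fun=> 1%:M) (fun k l => ((phi1 k) ^t* *m phi2 l) 0 0)) => //.
  - by rewrite -(orthonormal_total phi1P); apply: eq_bigr => k _; rewrite /J trmxCK.
  - rewrite -(orthonormal_total phi2P); apply: eq_bigr => l _.
    by rewrite big_ord1 /T trmxCK.
  - move=> l x l' x'; rewrite /T trmxCK phi2P !ord1 -pair_eqE /= andbT.
    by [].
  - move=> k l x; rewrite /J /T trmxCK; apply/matrixP => i j.
    by rewrite !ord1 [RHS]mxE [X in _ * X]mxE eqxx mulr1.
  - rewrite -/(r _) sigmaE -[RHS](sum_block _ phi1P); apply: eq_bigr => k _.
    by rewrite big_ord1 adjmx1 mul1mx mulmx1 /J trmxCK.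
rewrite vN_entropy1// mxE eqxx /= {1}/xlog2 /log2 ln1 mul0r mulr0 oppr0 -/log2.
have -> : \sum_k vN_entropy (J k *m s *m (J k) ^t*) = shannonM phi1 s.
  by rewrite /shannonM -sumrN; apply: eq_bigr => k _; rewrite /J trmxCK vN_entropy1.
have -> : \sum_l vN_entropy (r l) = shannonM phi2 s.
  by rewrite /shannonM -sumrN; apply: eq_bigr => l _; rewrite rE vN_entropy1.
have -> : \sum_l rtr (r l) * log2 (kap l) = \sum_l meas_prob phi2 s l * log2 (kap l).
  by apply: eq_bigr => l _; rewrite rE /rtr /mxtrace big_ord1.
lra.
Qed.
End Uncertainty.

(** * Overlaps of two orthonormal bases *)

Section Overlap.
Variable R : realType.
Local Notation C := R[i].

Lemma real_part_product_le (g a b : C) (t : R) : 0 <= t -> t ^+ 2 = normc2 g ->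
  2 * complex.Re (g * (Num.conj a * b)) <= t * (normc2 a + normc2 b).
Proof.
move: g a b => [g1 g2] [a1 a2] [b1 b2]; rewrite !normc2E /= => t0 tE.
have [t00|tN] := eqVneq t 0.
  have : g1 ^+ 2 + g2 ^+ 2 == 0 by rewrite -tE t00 expr0n.
  rewrite paddr_eq0 ?sqr_ge0// !sqrf_eq0 => /andP[/eqP-> /eqP->].
  by rewrite t00 !mul0r subrr mulr0.
have tp : 0 < t by rewrite lt_neqAle eq_sym tN.
rewrite -(ler_pM2l tp).
(* [0 <= |t a - g b|^2] *)
have := sqr_ge0 (t * a1 - (g1 * b1 - g2 * b2)).
have := sqr_ge0 (t * a2 - (g1 * b2 + g2 * b1)).
have tE' : t * (t * (a1 ^+ 2 + a2 ^+ 2 + (b1 ^+ 2 + b2 ^+ 2))) =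
  t ^+ 2 * (a1 ^+ 2 + a2 ^+ 2) + (g1 ^+ 2 + g2 ^+ 2) * (b1 ^+ 2 + b2 ^+ 2).
  by rewrite -tE; ring.
rewrite tE'; lra.
Qed.

(** The largest eigenvalue of [|v><v| + |w><w|] is at most [1 + t]. This follows by expanding the
    squared norm of [y = (1 + t) x - a v - b w] and bounding its cross term by
    [real_part_product_le]. *)
Lemma two_vectors_le n (v w x : 'cV[C]_n) (t : R) :
  v ^t* *m v = 1%:M -> w ^t* *m w = 1%:M -> 0 <= t ->
  t ^+ 2 = normc2 ((v ^t* *m w) 0 0) ->
  normc2 ((v ^t* *m x) 0 0) + normc2 ((w ^t* *m x) 0 0)
  <= (1 + t) * complex.Re ((x ^t* *m x) 0 0).
Proof.
move=> v1 w1 t0 tE.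
pose dot (y z : 'cV[C]_n) := (y ^t* *m z) 0 0.
have dotC y z : dot z y = Num.conj (dot y z).
  by rewrite /dot -[z ^t* *m y]trmxCK adjmxM trmxCK adjmxE.
have dot_lin y z1 z2 z3 (c1 c2 c3 : C) :
    dot y (c1 *: z1 - c2 *: z2 - c3 *: z3) = c1 * dot y z1 - c2 * dot y z2 - c3 * dot y z3.
  by rewrite /dot !mulmxBr -!scalemxAr !mxE.
set g := (v ^t* *m w) 0 0 in tE *.
set a := (v ^t* *m x) 0 0; set b := (w ^t* *m x) 0 0.
pose y := (1 + t)%:C *: x - a *: v - b *: w.
have dvv : dot v v = 1 by rewrite /dot v1 mxE eqxx.
have dww : dot w w = 1 by rewrite /dot w1 mxE eqxx.
have dvy : dot v y = t%:C * a - b * g.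
  by rewrite dot_lin dvv -/a -/g rmorphD rmorph1 /= /dot -/a -/g; ring.
have dwy : dot w y = t%:C * b - a * Num.conj g.
  by rewrite dot_lin dww (dotC v w) rmorphD rmorph1 /= /dot -/b -/g; ring.
have dxy : dot x y = (1 + t)%:C * dot x x - (normc2 a)%:C - (normc2 b)%:C.
  by rewrite dot_lin (dotC v x) (dotC w x) !normc2_mulC.
have := dot_lin y x v w (1 + t)%:C a b; rewrite -/y.
rewrite (dotC x y) (dotC v y) (dotC w y) dvy dwy dxy => dyy.
have t1 : 0 < 1 + t by rewrite ltr_wpDr.
have dyy0 : 0 <= complex.Re (dot y y).
  suff : 0 <= dot y y by rewrite lecE => /andP[].
  rewrite /dot mxE; apply: sumr_ge0 => i _.
  by rewrite adjmxE mulrC -normCK exprn_ge0.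
rewrite -(ler_pM2l t1) -/(dot x x); move: dyy0 (real_part_product_le a b t0 tE).
rewrite dyy !normc2E; clear dvy dwy dxy dyy y.
move: (dot x x) a b g {tE} => [X1 X2] [a1 a2] [b1 b2] [g1 g2] /=.
lra.
Qed.

Section Bounds.
Variables (d : nat) (phi1 phi2 : 'I_d -> 'cV[C]_d).
Hypotheses (phi1P : orthonormal_basis phi1) (phi2P : orthonormal_basis phi2).

Lemma overlap_ge0 k l : 0 <= overlap phi1 phi2 k l. Proof. exact: sqr_ge0. Qed.

Lemma sum_overlap l : \sum_k overlap phi1 phi2 k l = 1.
Proof.
have e k : overlap phi1 phi2 k l
    = complex.Re (((phi2 l) ^t* *m (phi1 k *m (phi1 k) ^t*) *m phi2 l) 0 0).
  rewrite -[LHS]Re_mul_conj mulrC; congr complex.Re.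
  have -> : (phi2 l) ^t* *m (phi1 k *m (phi1 k) ^t*) *m phi2 l
     = ((phi1 k) ^t* *m phi2 l) ^t* *m ((phi1 k) ^t* *m phi2 l).
    by rewrite adjmxM trmxCK !mulmxA.
  by rewrite [RHS]mxE big_ord1 adjmxE.
under eq_bigr do rewrite e.
rewrite -Re_sum -summxE -mulmx_suml -mulmx_sumr orthonormal_total// mulmx1 phi2P.
by rewrite !mxE !eqxx.
Qed.

Lemma overlap_sym k l : overlap phi2 phi1 l k = overlap phi1 phi2 k l.
Proof.
rewrite /overlap -/(normc2 _) -[RHS]normc2_conj -adjmxE.
by rewrite adjmxM trmxCK.
Qed.

Lemma overlap_le_col k l : overlap phi1 phi2 k l <= col_max phi1 phi2 l.
Proof. exact: (le_bigmax 0 (fun k => overlap phi1 phi2 k l)). Qed.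

Lemma overlap_le_row k l : overlap phi1 phi2 k l <= row_max phi1 phi2 k.
Proof. exact: (le_bigmax 0 (overlap phi1 phi2 k)). Qed.

Lemma row_max_le_c_max k : row_max phi1 phi2 k <= c_max phi1 phi2.
Proof. exact: (le_bigmax 0 (row_max phi1 phi2)). Qed.

Lemma col_max_gt0 l : 0 < col_max phi1 phi2 l.
Proof.
rewrite ltNge; apply/negP => c0; have := sum_overlap l; rewrite big1 => [/eqP|k _].
  by rewrite eq_sym oner_eq0.
by apply/eqP; rewrite eq_le overlap_ge0 andbT (le_trans (overlap_le_col k l)).
Qed.

Lemma row_maxE k : row_max phi1 phi2 k = col_max phi2 phi1 k.
Proof. by apply: eq_bigr => l _; rewrite overlap_sym. Qed.

Lemma col_max_le_c_max l : col_max phi1 phi2 l <= c_max phi1 phi2.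
Proof.
apply: bigmax_le => [|k _].
  by apply: bigmax_ge_id.
exact: le_trans (overlap_le_row k l) (row_max_le_c_max k).
Qed.

End Bounds.
End Overlap.

(** * Comparison of the three bounds *)

Section Compare.
Variable R : realType.
Local Notation C := R[i].

Lemma log2_le (x y : R) : 0 < x -> x <= y -> log2 x <= log2 y.
Proof.
move=> x0 xy; rewrite ler_wpM2r ?invr_ge0 ?ln_ge0 ?ler1n//.
by rewrite ler_ln ?posrE// (lt_le_trans x0).
Qed.

Lemma log2_inv (x : R) : 0 < x -> log2 (1 / x) = - log2 x.
Proof. by move=> x0; rewrite /log2 div1r lnV ?posrE// mulNr. Qed.

Lemma count_gt_second (t : seq R) : sorted >=%R t ->
  (count (fun z => (nth 0 t 1 < z)%R) t <= 1)%N.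
Proof.
case: t => [|a [|b t]]//=; first by case: (_ < _).
move=> /andP[_ bt]; rewrite ltxx add0n.
have -> : count (fun z => (b < z)%R) t = 0%N.
  apply/eqP; rewrite -leqn0 leqNgt -has_count -all_predC.
  have /allP le_b := order_path_min (rev_trans le_trans) bt.
  by apply/allP => z /le_b /=; rewrite -leNgt.
by case: (_ < _).
Qed.

(** The maximum dominates the average of the two lower bounds; [1 - (p + q) / 2 >= (1 - t) / 2]
    produces the factor one half in [q_tilde]. *)
Lemma average_le_max (A B l b t p q : R) : 0 <= b -> p + q <= 1 + t ->
  p * - l + (1 - p) * (b - l) <= A -> q * - l + (1 - q) * (b - l) <= B ->
  - l + 2^-1 * (1 - t) * b <= Num.max A B.
Proof.
move=> b0 pqt pA qB.
have mA : A <= Num.max A B by rewrite le_max lexx.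
have mB : B <= Num.max A B by rewrite le_max lexx orbT.
have bpq : (p + q) * b <= (1 + t) * b by rewrite ler_wpM2r.
by move: (Num.max A B) mA mB => M; lra.
Qed.

Section Fixed.
Variables (d : nat) (phi1 phi2 : 'I_d -> 'cV[C]_d).
Hypotheses (phi1P : orthonormal_basis phi1) (phi2P : orthonormal_basis phi2).
Let ov := overlap phi1 phi2.
Let c := c_max phi1 phi2.
Let c2 := c_2 phi1 phi2.

Let c2_mem (P : pred R) : P 0 -> (forall k l, P (ov k l)) -> P c2.
Proof.
move=> P0 Pov; rewrite /c2 /c_2; set t := sort _ _.
have [lt1|ge1] := ltnP 1 (size t); last by rewrite nth_default.
have : nth 0 t 1 \in t by apply: mem_nth.
by rewrite mem_sort => /allpairsP[[k l] [_ _ ->]]; apply: Pov.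
Qed.

(** Otherwise two positions would exceed the second entry of the sorted list. Positions are counted
    rather than values, so ties are covered. *)
Lemma overlap_le_c2 k l k' l' : (k, l) != (k', l') -> ov k l <= ov k' l' -> ov k l <= c2.
Proof.
move=> ne le'; rewrite leNgt; apply/negP => lt.
have lt' : c2 < ov k' l' by apply: lt_le_trans le'.
set s := [seq ov k l | k <- enum 'I_d, l <- enum 'I_d].
have := count_gt_second (sort_sorted ge_total s).
rewrite -/c2 -/(c_2 _ _).
have /permP -> : perm_eq (sort >=%R s) s by rewrite perm_sort.
pose u := [seq (k, l) | k <- enum 'I_d, l <- enum 'I_d].
have -> : s = [seq ov q.1 q.2 | q <- u] by rewrite /s /u map_allpairs.
rewrite count_map -size_filter leqNgt => /negP; apply.
have : uniq [:: (k, l); (k', l')] by rewrite /= inE ne.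
move=> /uniq_leq_size; apply => q; rewrite !inE mem_filter /= => /orP[] /eqP-> /=.
  by rewrite lt; apply: allpairs_f; rewrite mem_enum.
by rewrite lt'; apply: allpairs_f; rewrite mem_enum.
Qed.

Lemma c2_ge0 : 0 <= c2.
Proof. by apply: (c2_mem (P := fun z => 0 <= z)) => // k l; apply: overlap_ge0. Qed.

Lemma c2_le_c : c2 <= c.
Proof.
apply: (c2_mem (P := fun z => z <= c)) => [|k l]; first exact: bigmax_ge_id.
exact: le_trans (overlap_le_row _ _ k l) (row_max_le_c_max _ _ k).
Qed.

Lemma c_max_attained (i : 'I_d) : exists k l, ov k l = c.
Proof.
have [k _ E] := @eq_bigmax _ R 'I_d 0 i xpredT (row_max phi1 phi2) isT
  (fun _ _ => bigmax_ge_id _ _ _ _).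
have [l _ E'] := @eq_bigmax _ R 'I_d 0 i xpredT (ov k) isT
  (fun l _ => overlap_ge0 _ _ k l).
by exists k, l; rewrite -E' -/(row_max phi1 phi2 k) -E.
Qed.

Variable s : 'M[C]_d.
Hypothesis sD : density_mx s.

Lemma meas_prob_ge0 (phi : 'I_d -> 'cV[C]_d) k : 0 <= meas_prob phi s k.
Proof. by have [[_ /(_ (phi k))]] := sD; rewrite lecE => /andP[]. Qed.

Lemma sum_meas_prob (phi : 'I_d -> 'cV[C]_d) : orthonormal_basis phi ->
  \sum_k meas_prob phi s k = 1.
Proof.
move=> phiP; have [_ tr1] := sD.
have -> : 1 = complex.Re (\tr (s *m (\sum_k phi k *m (phi k) ^t*))).
  by rewrite orthonormal_total// mulmx1 tr1.
rewrite -/(rtr _) mulmx_sumr rtr_sum; apply: eq_bigr => k _.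
by rewrite mulmxA [RHS]rtr_mulC mulmxA /rtr /mxtrace big_ord1.
Qed.

(** With [s = N N^*], [two_vectors_le] applies to each column of [N], and the squared norms of the
    columns add up to the trace 1. *)
Lemma meas_prob_pair_le k l :
  meas_prob phi1 s k + meas_prob phi2 s l <= 1 + Num.sqrt (ov k l).
Proof.
have [/psd_gram[N sE] tr1] := sD.
have probE (phi : 'I_d -> 'cV[C]_d) i :
    meas_prob phi s i = \sum_j normc2 (((phi i) ^t* *m col j N) 0 0).
  rewrite /meas_prob sE.
  have -> : (phi i) ^t* *m (N *m N ^t*) *m phi i
      = ((phi i) ^t* *m N) *m ((phi i) ^t* *m N) ^t*.
    by rewrite adjmxM trmxCK !mulmxA.
  rewrite mxE Re_sum; apply: eq_bigr => j _; rewrite adjmxE Re_mul_conj.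
  by congr normc2; rewrite !mxE; apply: eq_bigr => x _; rewrite !mxE.
have trE : 1 = \sum_j complex.Re (((col j N) ^t* *m col j N) 0 0).
  rewrite -Re_sum -[LHS]/(complex.Re (1 : C)) -tr1 sE mxtrace_mulC; congr complex.Re.
  apply: eq_bigr => j _; rewrite !mxE; apply: eq_bigr => i _.
  by rewrite !mxE.
rewrite !probE -big_split /= -[leRHS]mulr1 [X in _ <= _ * X]trE mulr_sumr.
apply: ler_sum => j _; apply: two_vectors_le; rewrite ?sqrtr_ge0 ?phi1P ?phi2P ?eqxx//.
by rewrite sqr_sqrtr// overlap_ge0.
Qed.

(** Let [(k0, l0)] attain [c]. Every other row or column has maximum at most [c2], so each sum in
    [q_state] gains [log2 (c / c2)] on the probability outside [k0] or [l0]. Those two probabilities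
    cannot both be near 1, so averaging the sums gives the bound. *)
Lemma q_tilde_le_q_state : q_tilde phi1 phi2 <= q_state phi1 phi2 s.
Proof.
have [i _] : exists i : 'I_d, true.
  suff d0 : (0 < d)%N by exists (Ordinal d0).
  rewrite lt0n; apply/eqP => d0; have [_ /eqP] := sD; rewrite /mxtrace big1 => [|[m lm] _].
    by rewrite eq_sym oner_eq0.
  by exfalso; move: lm; rewrite d0.
have [k0 [l0 ovE]] := c_max_attained i.
have rpos k : 0 < row_max phi1 phi2 k by rewrite row_maxE col_max_gt0.
have cpos l : 0 < col_max phi1 phi2 l by apply: col_max_gt0.
have c0 : 0 < c by apply: lt_le_trans (cpos l0) (col_max_le_c_max _ _ l0).
pose p := meas_prob phi1 s; pose q := meas_prob phi2 s.
have p0 k : 0 <= p k by apply: meas_prob_ge0.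
have q0 k : 0 <= q k by apply: meas_prob_ge0.
have p1 : \sum_k p k = 1 by apply: sum_meas_prob.
have q1 : \sum_k q k = 1 by apply: sum_meas_prob.
have pq : p k0 + q l0 <= 1 + Num.sqrt c by rewrite -ovE; apply: meas_prob_pair_le.
have avg (w f : 'I_d -> R) (i0 : 'I_d) (a b : R) : (forall k, 0 <= w k) -> \sum_k w k = 1 ->
    a <= f i0 -> (forall k, k != i0 -> b <= f k) ->
    w i0 * a + (1 - w i0) * b <= \sum_k w k * f k.
  move=> w0 w1 fa fb; rewrite (bigD1 i0)//= lerD ?ler_wpM2l//.
  have -> : 1 - w i0 = \sum_(k | k != i0) w k by rewrite -w1 (bigD1 i0)//=; ring.
  by rewrite mulr_suml; apply: ler_sum => k ki; rewrite ler_wpM2l ?fb.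
have fA k x : row_max phi1 phi2 k <= x -> - log2 x <= log2 (1 / row_max phi1 phi2 k).
  by move=> kx; rewrite log2_inv// lerN2 log2_le.
have fB l x : col_max phi1 phi2 l <= x -> - log2 x <= log2 (1 / col_max phi1 phi2 l).
  by move=> kx; rewrite log2_inv// lerN2 log2_le.
rewrite /q_tilde /q_MU /q_state -/c -/c2.
suff [b [b0 bA bB ->]] : exists b, [/\ 0 <= b,
    p k0 * - log2 c + (1 - p k0) * (b - log2 c) <= \sum_k p k * log2 (1 / row_max phi1 phi2 k),
    q l0 * - log2 c + (1 - q l0) * (b - log2 c) <= \sum_l q l * log2 (1 / col_max phi1 phi2 l)
    & log2 (c / c2) = b].
  exact: average_le_max b0 pq bA bB.
(* For [c2 = 0] the default values give [log2 (c / c2) = 0], and the claim reduces to the bound by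
   [q_MU]. *)
have [c20|c2N] := eqVneq c2 0.
  exists 0; split => //; last by rewrite c20 invr0 mulr0 /log2 ln0// mul0r.
    apply: avg => // [|k _]; first by apply: fA; apply: row_max_le_c_max.
    by rewrite sub0r; apply: fA; apply: row_max_le_c_max.
  apply: avg => // [|l _]; first by apply: fB; apply: col_max_le_c_max.
  by rewrite sub0r; apply: fB; apply: col_max_le_c_max.
have c2p : 0 < c2 by rewrite lt_neqAle eq_sym c2N c2_ge0.
exists (log2 c - log2 c2); split.
- by rewrite subr_ge0 log2_le// c2_le_c.
- apply: avg => // [|k kk0]; first by apply: fA; apply: row_max_le_c_max.
  rewrite addrAC subrr sub0r; apply: fA; apply: bigmax_le => [|l _]; first exact: c2_ge0.
  apply: (@overlap_le_c2 _ _ k0 l0); first by rewrite -pair_eqE /= (negPf kk0).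
  by rewrite ovE; apply: le_trans (overlap_le_row _ _ k l) (row_max_le_c_max _ _ k).
- apply: avg => // [|l ll0]; first by apply: fB; apply: col_max_le_c_max.
  rewrite addrAC subrr sub0r; apply: fB; apply: bigmax_le => [|k _]; first exact: c2_ge0.
  apply: (@overlap_le_c2 _ _ k0 l0); first by rewrite -pair_eqE /= (negPf ll0) andbF.
  by rewrite ovE; apply: le_trans (overlap_le_row _ _ k l) (row_max_le_c_max _ _ k).
- by rewrite /log2 ln_div ?posrE// mulrBl.
Qed.
End Fixed.
End Compare.

(** * The optimized bound [q_opt] and the combination of the inequalities *)

Section Optimal.
Variable R : realType.
Local Notation C := R[i].

Lemma convex_le_max (p A B : R) : 0 <= p <= 1 -> p * A + (1 - p) * B <= Num.max A B.
Proof.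
move=> /andP[p0 p1].
have pA : p * A <= p * Num.max A B by rewrite ler_wpM2l// le_max lexx.
have pB : (1 - p) * B <= (1 - p) * Num.max A B.
  by rewrite ler_wpM2l ?subr_ge0// le_max lexx orbT.
by move: (Num.max A B) pA pB => M; lra.
Qed.

(** Here [T] is the sum of conditional entropies, [H] the sum of Shannon entropies, [S] the entropy
    of [A] and [D] is [Delta]. Relations with memory serve the value 0 of the second maximum, those
    without memory the value [D]. *)
Lemma max_add_max_le (A B D H S T : R) : A <= T -> B <= T ->
  S + A <= H -> S + B <= H -> T = H + D - S -> Num.max A B + Num.max 0 D <= T.
Proof.
move=> AT BT AH BH TE; case: (leP A B) => _; case: (leP 0 D) => _; lra.
Qed.

Lemma lambda_min_le n (H : 'M[C]_n) i : lambda_min H <= complex.Re (spectral_diag H 0 i).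
Proof.
rewrite /lambda_min; set l := [seq _ | _ <- _].
have : complex.Re (spectral_diag H 0 i) \in sort <=%R l.
  by rewrite mem_sort; apply/mapP; exists i; rewrite ?mem_enum.
have := sort_sorted (@le_total _ R) l.
case: (sort _ l) => //= a t /(order_path_min le_trans)/allP amin.
by rewrite inE => /orP[/eqP->//|/amin].
Qed.

(** In an eigenbasis of [H] the diagonal of [s] is a probability vector, and the trace is the mean
    of the eigenvalues under it. *)
Lemma lambda_min_le_rtr n (s H : 'M[C]_n) :
  density_mx s -> H \is hermsymmx -> lambda_min H <= rtr (s *m H).
Proof.
move=> [sP tr1] HH; have HE := hermsym_spectral HH.
have Uu := spectral_unitarymx H; have dle := lambda_min_le H.
move: (spectralmx H) (spectral_diag H) HE Uu dle => U d HE Uu dle.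
have [N NE] := psd_gram (psd_conj U sP).
have -> : rtr (s *m H) = \sum_i complex.Re ((U *m s *m U ^t*) i i) * complex.Re (d 0 i).
  have -> : rtr (s *m H) =
      rtr (U *m s *m U ^t* *m rdiag (fun i => complex.Re (d 0 i))).
    by rewrite {1}HE !mulmxA [LHS]rtr_mulC !mulmxA.
  rewrite /rtr Re_sum; apply: eq_bigr => i _.
  by rewrite mul_mx_diag mxE [(\row__ _) _ _]mxE Re_mulr.
have sum1 : \sum_i complex.Re ((U *m s *m U ^t*) i i) = 1.
  rewrite -Re_sum -[\sum_i _]/(\tr _) mxtrace_mulC mulmxA mul_adj_unitary//.
  by rewrite mul1mx tr1.
rewrite -[leLHS]mul1r -[in leLHS]sum1 mulr_suml; apply: ler_sum => i _.
apply: ler_wpM2l; last exact: dle.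
rewrite NE mxE Re_sum; apply: sumr_ge0 => j _.
by rewrite adjmxE Re_mul_conj normc2_ge0.
Qed.

Lemma hermsym_real_comb n (I : finType) (a : I -> R) (F : I -> 'M[C]_n) :
  (forall i, F i \is hermsymmx) -> \sum_i (a i)%:C *: F i \is hermsymmx.
Proof.
move=> FH; apply/is_hermitianmxP; rewrite expr0 scale1r adjmx_sum.
apply: eq_bigr => i _; have /is_hermitianmxP := FH i; rewrite expr0 scale1r => {1}->.
by rewrite linearZ /= map_mxZ /= conjC_real_complex.
Qed.

Lemma rtr_mul_proj_comb d (phi : 'I_d -> 'cV[C]_d) (s : 'M[C]_d) (a : 'I_d -> R) :
  rtr (s *m (\sum_k (a k)%:C *: proj (phi k))) = \sum_k meas_prob phi s k * a k.
Proof.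
rewrite mulmx_sumr rtr_sum; apply: eq_bigr => k _.
rewrite -scalemxAr rtrZ mulrC; congr (_ * _).
by rewrite /proj mulmxA rtr_mulC mulmxA /rtr /mxtrace big_ord1.
Qed.

Lemma rtr_mul_comb d (s H H' : 'M[C]_d) (a b : R) :
  rtr (s *m (a%:C *: H + b%:C *: H')) = a * rtr (s *m H) + b * rtr (s *m H').
Proof. by rewrite mulmxDr rtrD -!scalemxAr !rtrZ. Qed.

(** For each [p] the smallest eigenvalue is at most the expectation in [s], which is a convex
    combination of the two sums in [q_state]. *)
Lemma q_opt_le_q_state d (phi1 phi2 : 'I_d -> 'cV[C]_d) (s : 'M[C]_d) :
  density_mx s -> q_opt phi1 phi2 <= q_state phi1 phi2 s.
Proof.
move=> sD; apply: ge_sup.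
  by eexists; exists 0; [rewrite /= lexx ler01 | reflexivity].
move=> _ [p /= /andP[p0 p1] <-].
have projH (phi : 'I_d -> 'cV[C]_d) k : proj (phi k) \is hermsymmx by apply: gram_hermitian.
have H12 : Delta12 phi1 phi2 \is hermsymmx by apply: hermsym_real_comb.
have H21 : Delta21 phi1 phi2 \is hermsymmx by apply: hermsym_real_comb.
apply: le_trans (lambda_min_le_rtr sD _) _.
  have := @hermsym_real_comb _ bool (fun b => if b then p else 1 - p)
    (fun b => if b then Delta12 phi1 phi2 else Delta21 phi1 phi2).
  by rewrite big_bool; apply; case.
have e12 := rtr_mul_proj_comb phi1 s (fun k => log2 (1 / row_max phi1 phi2 k)).
have e21 := rtr_mul_proj_comb phi2 s (fun l => log2 (1 / col_max phi1 phi2 l)).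
rewrite rtr_mul_comb.
rewrite (congr2 (fun x y => p * x + (1 - p) * y) e12 e21 :
  _ * rtr (s *m Delta12 _ _) + _ * rtr (s *m Delta21 _ _) = _).
by apply: convex_le_max; rewrite p0.
Qed.

End Optimal.

(** * Marginals of the tripartite state and the final inequality *)

Section Final.
Variable R : realType.
Local Notation C := R[i].
Variables dA dB dC : nat.

Lemma ptrace1_rhoAB (rho : 'M[C]_(dA * (dB * dC))) : ptrace1 (rhoAB rho) = rhoB rho.
Proof.
by apply/matrixP => b b'; rewrite !mxE; apply: eq_bigr => a _; rewrite mxE !mxtens_indexK.
Qed.

Lemma ptrace1_rhoAC (rho : 'M[C]_(dA * (dB * dC))) : ptrace1 (rhoAC rho) = rhoC rho.
Proof.
by apply/matrixP => c c'; rewrite !mxE; apply: eq_bigr => a _; rewrite mxE !mxtens_indexK.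
Qed.

Lemma ptrace2_rhoAB (rho : 'M[C]_(dA * (dB * dC))) : ptrace2 (rhoAB rho) = rhoA rho.
Proof.
by apply/matrixP => a a'; rewrite !mxE; apply: eq_bigr => b _; rewrite mxE !mxtens_indexK.
Qed.

Lemma ptrace2_rhoAC (rho : 'M[C]_(dA * (dB * dC))) : ptrace2 (rhoAC rho) = rhoA rho.
Proof.
apply/matrixP => a a'; rewrite !mxE exchange_big; apply: eq_bigr => c _.
by rewrite mxE !mxtens_indexK.
Qed.

Lemma rhoA_density (rho : 'M[C]_(dA * (dB * dC))) : density_mx rho -> density_mx (rhoA rho).
Proof.
move=> [/psd_gram[M rhoE] tr1]; split; last first.
  rewrite -tr1 /mxtrace big_mxtens; apply: eq_bigr => a _.
  by rewrite mxE big_mxtens.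
(* The purification is reshaped with [B], [C] and the purifying index all on the column side. *)
pose N : 'M[C]_(dA, dB * (dC * (dA * (dB * dC)))) := \matrix_(a, j)
  M (idx3 a (mxtens_unindex j).1 (mxtens_unindex (mxtens_unindex j).2).1)
    (mxtens_unindex (mxtens_unindex j).2).2.
have -> : rhoA rho = N *m N ^t*; last exact: gram_psd.
apply/matrixP => a a'; rewrite !mxE big_mxtens; apply: eq_bigr => b _.
rewrite big_mxtens; apply: eq_bigr => c _; rewrite rhoE mxE; apply: eq_bigr => n _.
by rewrite !adjmxE !mxE !mxtens_indexK.
Qed.

End Final.

Unset Implicit Arguments.

Theorem theorem1 (R : realType) (dA dB dC : nat)
    (rho : 'M[R[i]]_(dA * (dB * dC))) (phi1 phi2 : 'I_dA -> 'cV[R[i]]_dA) :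
  density_mx rho -> orthonormal_basis phi1 -> orthonormal_basis phi2 ->
  let lhs := cond_entropy phi1 (rhoAB rho) (rhoB rho)
           + cond_entropy phi2 (rhoAC rho) (rhoC rho) in
  let Delta := vN_entropy (rhoA rho)
             - holevo phi1 (rhoA rho) (rhoAB rho) (rhoB rho)
             - holevo phi2 (rhoA rho) (rhoAC rho) (rhoC rho) in
  [/\ q_tilde phi1 phi2 + Num.max 0 Delta <= lhs,
      q_state phi1 phi2 (rhoA rho) + Num.max 0 Delta <= lhs &
      q_opt phi1 phi2 + Num.max 0 Delta <= lhs].
Proof.
move=> rhoD phi1P phi2P lhs Delta.
have sD := rhoA_density rhoD; set s := rhoA rho in sD *.
(* The state-dependent bound dominates the other two. *)
suff main : q_state phi1 phi2 s + Num.max 0 Delta <= lhs.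
  split=> //; apply: le_trans main; rewrite lerD2r.
    exact: q_tilde_le_q_state.
  exact: q_opt_le_q_state.
have [/psd_gram[M rhoE] _] := rhoD.
(* The column index of [M] labels the purifying system. In [G'] the systems [B] and [C] are
   exchanged. *)
pose G a b c n := M (idx3 a b c) n; pose G' a c b n := M (idx3 a b c) n.
have ABE : rhoAB rho = margin_AX G.
  apply/matrixP => i j; rewrite !mxE; apply: eq_bigr => c _.
  by rewrite rhoE mxE; apply: eq_bigr => n _; rewrite adjmxE.
have ACE : rhoAC rho = margin_AY G.
  apply/matrixP => i j; rewrite !mxE; apply: eq_bigr => b _.
  by rewrite rhoE mxE; apply: eq_bigr => n _; rewrite adjmxE.
have ABE' : rhoAB rho = margin_AY G' by rewrite ABE.
have ACE' : rhoAC rho = margin_AX G' by rewrite ACE.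
have cpos := @col_max_gt0 R dA phi1 phi2 phi1P phi2P.
have rpos k : 0 < row_max phi1 phi2 k by rewrite row_maxE col_max_gt0.
have rle l k : overlap phi2 phi1 l k <= row_max phi1 phi2 k.
  by rewrite overlap_sym overlap_le_row.
have log_col : \sum_l meas_prob phi2 s l * log2 (1 / col_max phi1 phi2 l)
    = - \sum_l meas_prob phi2 s l * log2 (col_max phi1 phi2 l).
  by rewrite -sumrN; apply: eq_bigr => l _; rewrite log2_inv// mulrN.
have log_row : \sum_k meas_prob phi1 s k * log2 (1 / row_max phi1 phi2 k)
    = - \sum_k meas_prob phi1 s k * log2 (row_max phi1 phi2 k).
  by rewrite -sumrN; apply: eq_bigr => k _; rewrite log2_inv// mulrN.
have mem_col := vN_entropy_tripartite G phi1P phi2P cpos (@overlap_le_col R dA phi1 phi2).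
(* Exchanging the measurements together with [B] and [C] preserves the left-hand side and turns
   column maxima into row maxima. *)
have mem_row := vN_entropy_tripartite G' phi2P phi1P rpos rle.
rewrite -ABE -ACE ptrace1_rhoAB ptrace1_rhoAC ptrace2_rhoAC -/s -/lhs in mem_col.
rewrite -ABE' -ACE' ptrace1_rhoAB ptrace1_rhoAC ptrace2_rhoAB -/s addrC -/lhs in mem_row.
have sh_col := shannon_uncertainty sD phi1P phi2P cpos (@overlap_le_col R dA phi1 phi2).
have sh_row := shannon_uncertainty sD phi2P phi1P rpos rle.
have -> : q_state phi1 phi2 s = _ := congr2 Num.max log_row log_col.
have lhsE : lhs = shannonM phi1 s + shannonM phi2 s + Delta - vN_entropy s.
  by rewrite /lhs /Delta /holevo /cond_entropy; ring.
rewrite [shannonM phi2 s + _]addrC in sh_row.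
exact: max_add_max_le mem_row mem_col sh_row sh_col lhsE.
Qed.
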